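(* Let $A$ be a unital algebra with differential graded algebra $(\Omega,\mathrm d)$ and let $(\nabla,\sigma)$ be a bimodule connection on $\Omega^1$ which is torsion free, flat, $\wedge$-compatible, extendable and Leibniz compatible. Suppose moreover that $$\mathrm{im}(\nabla^i)\subseteq\mathrm{im}\,[i,\sigma]!\qquad\text{for all }i\le k,$$ and let $d^i:A\to S^i_\sigma(\Omega^1)$ be such that $\nabla^i(a)=[i,\sigma]!(d^i(a))$. Then there is a reduced jet bimodule $$\mathcal J^k_\sigma=\bigoplus_{0\le i\le k}S^i_\sigma(\Omega^1),\quad a\bullet_k\omega=j^{k-j}_\sigma(a)\,\omega,\quad\omega\bullet_ka=\omega\,j^{k-j}_\sigma(a),\quad j^k_\sigma(a)=\sum_{0\le i\le k}d^i(a)$$ for all $a\in A$, $\omega\in S^j_\sigma(\Omega^1)$ (products in $S_\sigma(\Omega^1)$); i.e. $\bullet_k$ makes $\mathcal J^k_\sigma$ an $A$-bimodule and $j^k_\sigma:A\to\mathcal J^k_\sigma$ is a bimodule map. There is also a bimodule map $\mathcal J^k_\sigma\to\mathcal J^{k-1}_\sigma$ given by quotienting out the top degree, and its composition with $j^k_\sigma$ is $j^{k-1}_\sigma$.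
   Context: Everything is over a field. $A$ is a unital algebra and $(\Omega=\oplus_n\Omega^n,\mathrm d)$ is a differential graded algebra with $\Omega^0=A$, product $\wedge$, $\mathrm d^2=0$, graded Leibniz rule and $\Omega$ generated by $A,\mathrm dA$. $\Omega^{1\otimes_An}$ is the $n$-fold tensor power over $A$ (degree zero: $A$); $\wedge_i,\sigma_i$ denote $\wedge,\sigma$ in tensor factors $i,i+1$. A bimodule connection $(\nabla,\sigma)$ on $\Omega^1$ is a linear map $\nabla:\Omega^1\to\Omega^1\otimes_A\Omega^1$ and a bimodule map $\sigma:\Omega^1\otimes_A\Omega^1\to\Omega^1\otimes_A\Omega^1$ with $\nabla(a\omega)=\mathrm da\otimes\omega+a\nabla\omega$, $\nabla(\omega a)=(\nabla\omega)a+\sigma(\omega\otimes\mathrm da)$. Set $\nabla_0=\mathrm d$, $\nabla_1=\nabla$, $\nabla_n=\nabla\otimes\mathrm{id}^{n-1}+\sigma_1(\mathrm{id}\otimes\nabla_{n-1})$; $\nabla^0=\mathrm{id}_A$, $\nabla^ns=\nabla_{n-1}\cdots\nabla_1\mathrm ds$. Torsion free: $\wedge\nabla=\mathrm d$; flat: $(\mathrm d\otimes\mathrm{id}-\mathrm{id}\wedge\nabla)\nabla=0$; $\wedge$-compatible: $\nabla_{\Omega^2}(\eta\wedge\omega):=(\nabla\eta)\wedge\omega+\wedge_2\sigma_1(\eta\otimes\nabla\omega)$ is a well-defined bimodule connection on $\Omega^2$; extendable: $\omega\otimes\eta\wedge\zeta\mapsto\wedge_1\sigma_2\sigma_1(\omega\otimes\eta\otimes\zeta)$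 is a well-defined bimodule map $\Omega^1\otimes_A\Omega^2\to\Omega^2\otimes_A\Omega^1$; Leibniz compatible: $\nabla_2\sigma_1=\sigma_2\nabla_2$ on $\Omega^1\otimes_A\Omega^1$ (this implies the braid relations for $\sigma$). Braided integers and factorials on $\Omega^{1\otimes_An}$: $[n,\sigma]=\mathrm{id}+\sigma_{n-1}+\sigma_{n-2}\sigma_{n-1}+\cdots+\sigma_1\cdots\sigma_{n-1}$, $[n,\sigma]!=[n,\sigma]([n-1,\sigma]!\otimes\mathrm{id})$, with $[0,\sigma]!$ the identity of $A$ and $[1,\sigma]!=\mathrm{id}$. The braided-symmetric algebra is the graded algebra $S_\sigma(\Omega^1)=T_A\Omega^1/\oplus_k\ker[k,\sigma]!$, a quotient of the tensor algebra $T_A\Omega^1=\oplus_n\Omega^{1\otimes_An}$, with degree $i$ part $S^i_\sigma(\Omega^1)=\Omega^{1\otimes_Ai}/\ker[i,\sigma]!$; the map $[i,\sigma]!$ is regarded as defined (and injective) on $S^i_\sigma(\Omega^1)$, so $d^i$ is uniquely determined. *)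

(* Defs.v *)
From HB Require Import structures.
From mathcomp Require Import all_boot all_order all_algebra.
From mathcomp Require Import generic_quotient ring_quotient.
From mathcomp Require Import boolp classical_sets.

Set Implicit Arguments.
Unset Strict Implicit.
Unset Printing Implicit Defensive.

Import GRing.Theory.
Local Open Scope ring_scope.
Local Open Scope quotient_scope.

(* The axioms are relative to a subset [P] closed under all the operations, so
   that they also apply to a subspace of a larger space.  [K] acts centrally
   because [l] and [r] are [K]-linear in the algebra argument. *)
Definition bimodule_on (K : fieldType) (A : algType K) (V : lmodType K)
    (P : set V) (l : A -> V -> V) (r : V -> A -> V) : Prop :=
  [/\ [/\ P 0, forall c x y, P x -> P y -> P (c *: x + y),
          forall a x, P x -> P (l a x) & forall x a, P x -> P (r x a)],
      [/\ forall x, P x -> l 1 x = x,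
          forall a b x, P x -> l (a * b) x = l a (l b x),
          forall c a b x, P x -> l (c *: a + b) x = c *: l a x + l b x &
          forall a c x y, P x -> P y -> l a (c *: x + y) = c *: l a x + l a y],
      [/\ forall x, P x -> r x 1 = x,
          forall a b x, P x -> r x (a * b) = r (r x a) b,
          forall c a b x, P x -> r x (c *: a + b) = c *: r x a + r x b &
          forall a c x y, P x -> P y -> r (c *: x + y) a = c *: r x a + r y a] &
      forall a b x, P x -> l a (r x b) = r (l a x) b].

Record bimodule (K : fieldType) (A : algType K) := Bimodule {
  bim_car :> lmodType K;
  lact : A -> bim_car -> bim_car;
  ract : bim_car -> A -> bim_car;
  bim_ax : bimodule_on setT lact ract }.

Definition bimodule_map_on (K : fieldType) (A : algType K)
    (V W : lmodType K) (P : set V) (lV : A -> V -> V) (rV : V -> A -> V)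
    (Q : set W) (lW : A -> W -> W) (rW : W -> A -> W) (f : V -> W) : Prop :=
  [/\ forall x, P x -> Q (f x),
      forall c x y, P x -> P y -> f (c *: x + y) = c *: f x + f y,
      forall a x, P x -> f (lV a x) = lW a (f x) &
      forall x a, P x -> f (rV x a) = rW (f x) a].

Definition bimodule_map (K : fieldType) (A : algType K) (M N : bimodule A)
    (f : M -> N) : Prop :=
  bimodule_map_on setT (@lact K A M) (@ract K A M)
                  setT (@lact K A N) (@ract K A N) f.

Section BimoduleTheory.
Variables (K : fieldType) (A : algType K) (M : bimodule A).
Implicit Types (a b : A) (x y : M) (c : K).

Lemma lact1 x : lact 1 x = x.
Proof. by case: (bim_ax M) => _ [H _ _ _] _ _; exact: H. Qed.
Lemma lactM a b x : lact (a * b) x = lact a (lact b x).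
Proof. by case: (bim_ax M) => _ [_ H _ _] _ _; exact: H. Qed.
Lemma lact_linl x : linear ((@lact K A M)^~ x).
Proof. by case: (bim_ax M) => _ [_ _ H _] _ _ c a b; exact: H. Qed.
Lemma lact_linr a : linear (lact a : M -> M).
Proof. by case: (bim_ax M) => _ [_ _ _ H] _ _ c x y; exact: H. Qed.
Lemma ract1 x : ract x 1 = x.
Proof. by case: (bim_ax M) => _ _ [H _ _ _] _; exact: H. Qed.
Lemma ractM x a b : ract x (a * b) = ract (ract x a) b.
Proof. by case: (bim_ax M) => _ _ [_ H _ _] _; exact: H. Qed.
Lemma ract_linr x : linear (ract x).
Proof. by case: (bim_ax M) => _ _ [_ _ H _] _ c a b; exact: H. Qed.
Lemma ract_linl a : linear ((@ract K A M)^~ a).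
Proof. by case: (bim_ax M) => _ _ [_ _ _ H] _ c x y; exact: H. Qed.
Lemma lact_ract a x b : lact a (ract x b) = ract (lact a x) b.
Proof. by case: (bim_ax M) => _ _ _; apply. Qed.

End BimoduleTheory.

Section LinearFun.
Variables (K : fieldType) (V W : lmodType K) (f : V -> W).
Hypothesis lf : linear f.
Lemma lin0 : f 0 = 0.
Proof. by have := lf (-1) 0 0; rewrite scaler0 addr0 scaleN1r addNr. Qed.
Lemma linD x y : f (x + y) = f x + f y.
Proof. by have := lf 1 x y; rewrite !scale1r. Qed.
Lemma linZ c x : f (c *: x) = c *: f x.
Proof. by have := lf c x 0; rewrite lin0 !addr0. Qed.
Lemma linN x : f (- x) = - f x.
Proof. by rewrite -scaleN1r linZ scaleN1r. Qed.
Lemma lin_sum I (s : seq I) (P : pred I) (F : I -> V) :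
  f (\sum_(i <- s | P i) F i) = \sum_(i <- s | P i) f (F i).
Proof. exact: (big_morph f linD lin0). Qed.
End LinearFun.

Section Regular.
Variables (K : fieldType) (A : algType K).
Lemma regular_ax : bimodule_on setT (fun a x : A => a * x) (fun x a : A => x * a).
Proof.
split; first by [].
- by split=> *; rewrite ?mul1r ?mulrA ?mulrDl ?mulrDr -?scalerAl -?scalerAr.
- by split=> *; rewrite ?mulr1 ?mulrA ?mulrDl ?mulrDr -?scalerAl -?scalerAr.
- by move=> a b x _; rewrite mulrA.
Qed.
Definition regular : bimodule A := Bimodule regular_ax.
End Regular.

Definition balanced (K : fieldType) (A : algType K) (M N : bimodule A)
    (P : lmodType K) (f : M -> N -> P) : Prop :=
  [/\ forall y, linear (f^~ y), forall x, linear (f x) &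
      forall x a y, f (ract x a) y = f x (lact a y)].

Section Tensor.
Variables (K : fieldType) (A : algType K) (M N : bimodule A).

(* A list [:: (x1, y1); ...; (xn, yn)] stands for the formal sum of the
   x_i (x) y_i; [teq] is the congruence generated by the tensor relations. *)
Inductive teq : seq (M * N) -> seq (M * N) -> Prop :=
| teq_refl s : teq s s
| teq_sym s t : teq s t -> teq t s
| teq_trans s t u : teq s t -> teq t u -> teq s u
| teq_cat s s' t t' : teq s s' -> teq t t' -> teq (s ++ t) (s' ++ t')
| teq_catC s t : teq (s ++ t) (t ++ s)
| teq_0 y : teq [:: (0, y)] [::]
| teq_Dl x x' y : teq [:: (x + x', y)] [:: (x, y); (x', y)]
| teq_Dr x y y' : teq [:: (x, y + y')] [:: (x, y); (x, y')]
| teq_bal x a y : teq [:: (ract x a, y)] [:: (x, lact a y)].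

Definition teqb (s t : seq (M * N)) : bool := `[< teq s t >].

Lemma teqb_equiv : equiv_class_of teqb.
Proof.
split=> [s|s t|t s u].
- by apply/asboolP; exact: teq_refl.
- by apply/asboolP/asboolP; exact: teq_sym.
- by move=> /asboolP st /asboolP tu; apply/asboolP; exact: teq_trans tu.
Qed.

Canonical teqb_equivRel := EquivRelPack teqb_equiv.

Definition tens := {eq_quot teqb}.
HB.instance Definition _ := Choice.on tens.
HB.instance Definition _ := EqQuotient.on tens.

Definition pit (s : seq (M * N)) : tens := \pi_tens s.

Lemma pitW (P : tens -> Prop) : (forall s, P (pit s)) -> forall u, P u.
Proof. by move=> H u; rewrite -[u]reprK; exact: H. Qed.

Lemma pit_eq s t : pit s = pit t <-> teq s t.
Proof. by split=> [/eqmodP/asboolP|st] //; apply/eqmodP/asboolP. Qed.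

Lemma repr_teq s : teq (repr (pit s)) s.
Proof. by apply/pit_eq; rewrite /pit reprK. Qed.

Definition tens_add (u v : tens) : tens := pit (repr u ++ repr v).

Lemma tens_addE s t : tens_add (pit s) (pit t) = pit (s ++ t).
Proof. by apply/pit_eq/teq_cat; exact: repr_teq. Qed.

Definition tens_map (f : M -> M) (g : N -> N) (u : tens) : tens :=
  pit [seq (f p.1, g p.2) | p <- repr u].

Lemma tens_mapE f g s :
  linear f -> linear g ->
  (forall x a, f (ract x a) = ract (f x) a) ->
  (forall a y, g (lact a y) = lact a (g y)) ->
  tens_map f g (pit s) = pit [seq (f p.1, g p.2) | p <- s].
Proof.
move=> lf lg fr gl; apply/pit_eq.
move: (repr_teq s); move: (repr _) => t; elim=> {s t}.
- by move=> *; exact: teq_refl.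
- by move=> *; exact: teq_sym.
- by move=> s t u _ st _; exact: teq_trans.
- by move=> s s' t t' _ H _ H'; rewrite !map_cat; exact: teq_cat.
- by move=> s t; rewrite !map_cat; exact: teq_catC.
- by move=> y /=; rewrite lin0 //; exact: teq_0.
- by move=> x x' y /=; rewrite linD //; exact: teq_Dl.
- by move=> x y y' /=; rewrite linD //; exact: teq_Dr.
- by move=> x a y /=; rewrite fr gl; exact: teq_bal.
Qed.

Definition tens_opp := tens_map -%R id.
Definition tens_scale (c : K) := tens_map ( *:%R c) id.
Definition tens_lact (a : A) := tens_map (lact a) id.
Definition tens_ract (u : tens) (a : A) := tens_map id ((@ract K A N)^~ a) u.

Lemma id_lin (V : lmodType K) : linear (@id V). Proof. by []. Qed.
Lemma scale_lin (V : lmodType K) (c : K) : linear ( *:%R c : V -> V).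
Proof. by move=> b x y; rewrite scalerDr !scalerA mulrC. Qed.
Lemma opp_lin (V : lmodType K) : linear (-%R : V -> V).
Proof. by move=> b x y; rewrite opprD scalerN. Qed.

Lemma tens_oppE s : tens_opp (pit s) = pit [seq (- p.1, p.2) | p <- s].
Proof.
apply: tens_mapE => //; first exact: opp_lin.
by move=> x a; rewrite (linN (ract_linl a)).
Qed.
Lemma tens_scaleE c s : tens_scale c (pit s) = pit [seq (c *: p.1, p.2) | p <- s].
Proof.
apply: tens_mapE => //; first exact: scale_lin.
by move=> x a; rewrite (linZ (ract_linl a)).
Qed.
Lemma tens_lactE a s : tens_lact a (pit s) = pit [seq (lact a p.1, p.2) | p <- s].
Proof.
apply: tens_mapE => //; first exact: lact_linr.
by move=> x b; rewrite lact_ract.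
Qed.
Lemma tens_ractE s a : tens_ract (pit s) a = pit [seq (p.1, ract p.2 a) | p <- s].
Proof.
apply: tens_mapE => //; first exact: ract_linl.
by move=> b x; rewrite lact_ract.
Qed.

Lemma tens_addA : associative tens_add.
Proof.
by elim/pitW=> s; elim/pitW=> t; elim/pitW=> u; rewrite !tens_addE catA.
Qed.
Lemma tens_addC : commutative tens_add.
Proof.
by elim/pitW=> s; elim/pitW=> t; rewrite !tens_addE; exact/pit_eq/teq_catC.
Qed.
Lemma tens_add0 : left_id (pit [::]) tens_add.
Proof. by elim/pitW=> s; rewrite tens_addE. Qed.
Lemma tens_addN : left_inverse (pit [::]) tens_opp tens_add.
Proof.
elim/pitW=> s; rewrite tens_oppE tens_addE.
elim: s => [//|[x y] s IH].
rewrite map_cons -cat1s -[(x, y) :: s]cat1s -!tens_addE.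
rewrite [tens_add _ (pit [seq _ | _ <- _])]tens_addC -!tens_addA.
rewrite [X in tens_add _ X]tens_addA tens_addE cat1s /=.
suff -> : pit [:: (- x, y); (x, y)] = pit [::].
  by rewrite tens_add0 tens_addE.
apply/pit_eq/(teq_trans (teq_sym (teq_Dl _ _ _))).
by rewrite addNr; exact: teq_0.
Qed.

HB.instance Definition _ := GRing.isZmodule.Build tens
  tens_addA tens_addC tens_add0 tens_addN.

Lemma pit_add s t : pit s + pit t = pit (s ++ t).
Proof. exact: tens_addE. Qed.
Lemma pit_nil : pit [::] = 0. Proof. by []. Qed.

Definition tm (x : M) (y : N) : tens := pit [:: (x, y)].

Lemma pitE s : pit s = \sum_(p <- s) tm p.1 p.2.
Proof.
elim: s => [|[x y] s IH]; first by rewrite big_nil.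
by rewrite big_cons -IH pit_add.
Qed.

Lemma tens_ind (P : tens -> Prop) :
  P 0 -> (forall x y u, P u -> P (tm x y + u)) -> forall u, P u.
Proof.
move=> P0 PD; elim/pitW=> s; rewrite pitE.
by elim: s => [|[x y] s IH]; rewrite ?big_nil // big_cons; exact: PD.
Qed.

Lemma tmDl x x' y : tm (x + x') y = tm x y + tm x' y.
Proof. by rewrite pit_add; apply/pit_eq; exact: teq_Dl. Qed.
Lemma tmDr x y y' : tm x (y + y') = tm x y + tm x y'.
Proof. by rewrite pit_add; apply/pit_eq; exact: teq_Dr. Qed.
Lemma tm_bal x a y : tm (ract x a) y = tm x (lact a y).
Proof. by apply/pit_eq; exact: teq_bal. Qed.
Lemma tmZ c x y : tm (c *: x) y = tm x (c *: y).
Proof.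
have -> : c *: x = ract x (c *: 1) by rewrite (linZ (ract_linr x)) ract1.
have {2}-> : y = lact 1 y by rewrite lact1.
by rewrite tm_bal (linZ (lact_linl y)).
Qed.

Lemma tens_scaleA b c u : tens_scale b (tens_scale c u) = tens_scale (b * c) u.
Proof.
move: u; elim/pitW=> s; rewrite !tens_scaleE -map_comp; congr (pit _).
by apply: eq_map => p /=; rewrite scalerA.
Qed.
Lemma tens_scale1 : left_id 1 tens_scale.
Proof.
elim/pitW=> s; rewrite tens_scaleE -[in RHS](map_id s); congr (pit _).
by apply: eq_map => -[x y] /=; rewrite scale1r.
Qed.
Lemma tens_scaleDr : right_distributive tens_scale +%R.
Proof.
move=> c; elim/pitW=> s; elim/pitW=> t.
by rewrite pit_add !tens_scaleE map_cat -pit_add.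
Qed.
Lemma tens_scaleDl u : {morph tens_scale^~ u : b c / b + c}.
Proof.
move=> b c; move: u; elim/pitW=> s; rewrite !tens_scaleE !pitE !big_map -big_split.
by apply: eq_bigr => p _ /=; rewrite scalerDl tmDl.
Qed.

HB.instance Definition _ := GRing.Zmodule_isLmodule.Build K tens
  tens_scaleA tens_scale1 tens_scaleDr tens_scaleDl.

Lemma scale_pit c s : c *: pit s = pit [seq (c *: p.1, p.2) | p <- s].
Proof. exact: tens_scaleE. Qed.

Lemma tens_bimodule_ax : bimodule_on [set: tens] tens_lact tens_ract.
Proof.
split; first by [].
- split.
  + elim/pitW=> s _; rewrite tens_lactE -[in RHS](map_id s); congr (pit _).
    by apply: eq_map => -[x y] /=; rewrite lact1.
  + move=> a b; elim/pitW=> s _; rewrite !tens_lactE -map_comp; congr (pit _).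
    by apply: eq_map => p /=; rewrite lactM.
  + move=> c a b; elim/pitW=> s _; rewrite !tens_lactE scale_pit -map_comp.
    rewrite !pitE !big_map -big_split; apply: eq_bigr => p _ /=.
    by rewrite lact_linl tmDl.
  + move=> a c; elim/pitW=> s; elim/pitW=> t _ _.
    rewrite (scale_pit c s) pit_add !tens_lactE scale_pit pit_add.
    rewrite map_cat -!map_comp; congr (pit (_ ++ _)).
    by apply: eq_map => p /=; rewrite (linZ (lact_linr a)).
- split.
  + elim/pitW=> s _; rewrite tens_ractE -[in RHS](map_id s); congr (pit _).
    by apply: eq_map => -[x y] /=; rewrite ract1.
  + move=> a b; elim/pitW=> s _; rewrite !tens_ractE -map_comp; congr (pit _).
    by apply: eq_map => p /=; rewrite ractM.
  + move=> c a b; elim/pitW=> s _; rewrite !tens_ractE scale_pit -map_comp.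
    rewrite !pitE !big_map -big_split; apply: eq_bigr => p _ /=.
    by rewrite ract_linr tmDr -tmZ.
  + move=> a c; elim/pitW=> s; elim/pitW=> t _ _.
    rewrite (scale_pit c s) pit_add !tens_ractE scale_pit pit_add.
    by rewrite map_cat -!map_comp.
- move=> a b; elim/pitW=> s _.
  by rewrite (tens_ractE s) !tens_lactE tens_ractE -!map_comp.
Qed.

Definition tensor : bimodule A := Bimodule tens_bimodule_ax.

Definition tmul (x : M) (y : N) : tensor := tm x y.

Lemma tmul_balanced : balanced tmul.
Proof.
split=> [y c x x'|x c y y'|x a y]; last exact: tm_bal.
- by rewrite /tmul tmDl; congr (_ + _); rewrite scale_pit.
- by rewrite /tmul tmDr -tmZ; congr (_ + _); rewrite scale_pit.
Qed.

Lemma lact_tmul a x y : lact a (tmul x y) = tmul (lact a x) y.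
Proof. exact: tens_lactE. Qed.
Lemma ract_tmul a x y : ract (tmul x y) a = tmul x (ract y a).
Proof. exact: tens_ractE. Qed.

Lemma tensor_ind (P : tensor -> Prop) :
  P 0 -> (forall x y u, P u -> P (tmul x y + u)) -> forall u, P u.
Proof. exact: tens_ind. Qed.

(* The linear map x (x) y |-> f x y if [f] is balanced, and 0 otherwise. *)
Definition tlift (P : lmodType K) (f : M -> N -> P) (u : tensor) : P :=
  if `[< balanced f >] then \sum_(p <- repr (u : tens)) f p.1 p.2 else 0.

Section Lift.
Variables (P : lmodType K) (f : M -> N -> P).

Lemma teq_lift s t : balanced f -> teq s t ->
  \sum_(p <- s) f p.1 p.2 = \sum_(p <- t) f p.1 p.2.
Proof.
case=> fl fr fb; elim=> {s t}.
- by [].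
- by move=> s t _ ->.
- by move=> s t u _ -> _ ->.
- by move=> s s' t t' _ H _ H'; rewrite !big_cat /= H H'.
- by move=> s t; rewrite !big_cat /= addrC.
- by move=> y; rewrite big_seq1 big_nil /= (lin0 (fl y)).
- by move=> x x' y; rewrite !big_cons !big_nil !addr0 /= (linD (fl y)).
- by move=> x y y'; rewrite !big_cons !big_nil !addr0 /= (linD (fr x)).
- by move=> x a y; rewrite !big_seq1 /= fb.
Qed.

Lemma tlift_pit s : balanced f ->
  tlift f (pit s) = \sum_(p <- s) f p.1 p.2.
Proof.
by move=> fb; rewrite /tlift asboolT //; apply: teq_lift fb _; exact: repr_teq.
Qed.

Lemma tlift_linear : linear (tlift f).
Proof.
case: (pselect (balanced f)) => [fb|nfb]; last first.
  by move=> c u v; rewrite /tlift asboolF // scaler0 addr0.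
move=> c; elim/pitW=> s; elim/pitW=> t; rewrite scale_pit pit_add.
rewrite !tlift_pit // big_cat big_map scaler_sumr; congr (_ + _).
by case: fb => fl _ _; apply: eq_bigr => p _ /=; rewrite (linZ (fl _)).
Qed.

Lemma tliftE x y : balanced f -> tlift f (tmul x y) = f x y.
Proof. by move=> fb; rewrite tlift_pit // big_seq1. Qed.

End Lift.

Lemma tensor_ext (P : lmodType K) (g h : tensor -> P) :
  linear g -> linear h -> (forall x y, g (tmul x y) = h (tmul x y)) -> g =1 h.
Proof.
move=> lg lh gh; apply: tensor_ind => [|x y u IH]; first by rewrite !lin0.
by rewrite !linD // gh IH.
Qed.

End Tensor.

Section TensorPower.
Variables (K : fieldType) (A : algType K) (M : bimodule A).

Fixpoint tpowS (n : nat) : bimodule A :=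
  if n is m.+1 then tensor M (tpowS m) else M.

(* Right-nested: A, M, M (x) M, M (x) (M (x) M), ... *)
Definition tpow (n : nat) : bimodule A :=
  if n is m.+1 then tpowS m else regular A.

(* x, v |-> x (x) v, where M (x)_A A is identified with M. *)
Definition tcons (n : nat) : M -> tpow n -> tpow n.+1 :=
  match n return M -> tpow n -> tpow n.+1 with
  | 0 => fun x a => ract x a
  | m.+1 => fun x v => tmul x v
  end.

(* The linear map tcons x v |-> f x v if [f] is balanced, and 0 otherwise. *)
Definition plift (P : lmodType K) (n : nat) :
    (M -> tpow n -> P) -> tpow n.+1 -> P :=
  match n return (M -> tpow n -> P) -> tpow n.+1 -> P with
  | 0 => fun f x => if `[< balanced f >] then f x 1 else 0
  | m.+1 => fun f => tlift f
  end.

Lemma tcons_balanced n : balanced (@tcons n).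
Proof.
case: n => [|n]; last exact: tmul_balanced.
split=> [a|x|x a b] /=; [exact: ract_linl | exact: ract_linr |].
by rewrite ractM.
Qed.

Lemma pliftE (P : lmodType K) n (f : M -> tpow n -> P) x v :
  balanced f -> plift f (tcons x v) = f x v.
Proof.
case: n f v => [|n] f v bf; last exact: tliftE.
by rewrite /= asboolT //; case: bf => _ _ ->; rewrite /= mulr1.
Qed.

Lemma plift_linear (P : lmodType K) n (f : M -> tpow n -> P) : linear (plift f).
Proof.
case: n f => [|n] f; last exact: tlift_linear.
case: (pselect (balanced f)) => bf c x y /=.
  by rewrite asboolT //; case: bf => fl _ _; exact: fl.
by rewrite asboolF // scaler0 addr0.
Qed.

Lemma tpow_ind n (P : tpow n.+1 -> Prop) :
  P 0 -> (forall x v u, P u -> P (tcons x v + u)) -> forall u, P u.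
Proof.
case: n P => [|n] P P0 PD; last exact: tensor_ind.
by move=> u; rewrite -[u]addr0 -[u]ract1; exact: PD.
Qed.

Lemma tpow_ext (P : lmodType K) n (g h : tpow n.+1 -> P) :
  linear g -> linear h ->
  (forall x v, g (tcons x v) = h (tcons x v)) -> g =1 h.
Proof.
move=> lg lh gh; apply: tpow_ind => [|x v u IH]; first by rewrite !lin0.
by rewrite !linD // gh IH.
Qed.

Lemma lact_tcons n a x (v : tpow n) : lact a (tcons x v) = tcons (lact a x) v.
Proof. by case: n v => [|n] v; [exact: lact_ract | exact: lact_tmul]. Qed.

Lemma ract_tcons n a x (v : tpow n) : ract (tcons x v) a = tcons x (ract v a).
Proof. by case: n v => [|n] v; [rewrite /= ractM | exact: ract_tmul]. Qed.

Fixpoint tcat (m n : nat) : tpow m -> tpow n -> tpow (m + n) :=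
  match m return tpow m -> tpow n -> tpow (m + n) with
  | 0 => fun a v => lact a v
  | m'.+1 => fun t v => plift (fun x u => tcons x (tcat u v) : tpow (m' + n).+1) t
  end.

Lemma tcat_lin_lact m n :
  [/\ forall v : tpow n, linear (fun u : tpow m => tcat u v),
      forall u : tpow m, linear (fun v : tpow n => tcat u v) &
      forall a (u : tpow m) (v : tpow n), tcat (lact a u) v = lact a (tcat u v)].
Proof.
elim: m => [|m [IHl IHr IHa]].
  split=> [v|u|a u v] /=; [exact: lact_linl | exact: lact_linr |].
  by rewrite lactM.
have bal (v : tpow n) :
    balanced (fun x (u : tpow m) => tcons x (tcat u v) : tpow (m + n).+1).
  have [bl br bb] := tcons_balanced (m + n).
  split=> [y|x|x a y]; first exact: bl.
    by move=> c u u'; rewrite IHl; exact: br.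
  by rewrite IHa bb.
split=> [v|u|a u v]; first exact: plift_linear.
- elim/tpow_ind: u => [|x w u IH] c v v'.
    by rewrite /= !(lin0 (plift_linear _)) scaler0 addr0.
  have [bl br bb] := tcons_balanced (m + n).
  have E (z : tpow n) : tcat (tcons x w + u : tpow m.+1) z =
      (tcons x (tcat w z) : tpow (m + n).+1) + tcat (u : tpow m.+1) z.
    by rewrite /= (linD (plift_linear _)) (pliftE _ _ (bal z)).
  rewrite !E IHr IH (br x) scalerDr -!addrA; congr (_ + _).
  by rewrite addrCA.
- elim/tpow_ind: u => [|x w u IH].
    by rewrite (lin0 (lact_linr a)) /= !(lin0 (plift_linear _)) (lin0 (lact_linr a)).
  move: IH; rewrite /= !(linD (lact_linr a)) !(linD (plift_linear _)) => ->.
  rewrite lact_tcons !(pliftE _ _ (bal v)).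
  by rewrite (linD (lact_linr a)) lact_tcons.
Qed.

Lemma tcat_linl m n (v : tpow n) : linear (fun u : tpow m => tcat u v).
Proof. by case: (tcat_lin_lact m n) => H _ _; exact: H. Qed.
Lemma tcat_linr m n (u : tpow m) : linear (fun v : tpow n => tcat u v).
Proof. by case: (tcat_lin_lact m n) => _ H _; exact: H. Qed.
Lemma lact_tcat m n a (u : tpow m) (v : tpow n) :
  lact a (tcat u v) = tcat (lact a u) v.
Proof. by case: (tcat_lin_lact m n). Qed.

Lemma tcat_tcons m n x (u : tpow m) (v : tpow n) :
  tcat (tcons x u) v = tcons x (tcat u v) :> tpow (m + n).+1.
Proof.
apply: (pliftE (f := fun x (u : tpow m) => tcons x (tcat u v) : tpow (m + n).+1)).
have [bl br bb] := tcons_balanced (m + n).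
split=> [y|y|y a w]; first exact: bl.
  by move=> c w w'; rewrite tcat_linl; exact: br.
by rewrite -lact_tcat bb.
Qed.

Lemma tcat1 n (x : M) (v : tpow n) : @tcat 1 n x v = tcons x v.
Proof.
have E := @tcat_tcons 0 n x 1 v.
rewrite (ract1 x : @tcons 0 x 1 = x) in E.
exact: (etrans E (congr1 (tcons x) (lact1 v))).
Qed.

Lemma tcat2 n (x y : M) (v : tpow n) :
  @tcat 2 n (tmul x y) v = tcons x (tcons y v).
Proof. by have := @tcat_tcons 1 n x y v; rewrite tcat1. Qed.

Lemma tcat_bal m n (u : tpow m) a (v : tpow n) :
  tcat (ract u a) v = tcat u (lact a v).
Proof.
elim: m u => [|m IH] u /=; first by rewrite lactM.
elim/tpow_ind: u => [|x w u IHu].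
  by rewrite (lin0 (ract_linl a)) !(lin0 (plift_linear _)).
rewrite (linD (ract_linl a)) !(linD (plift_linear _)) IHu; congr (_ + _).
by rewrite ract_tcons -/(tcat (tcons x _ : tpow m.+1) _) tcat_tcons IH -tcat_tcons.
Qed.

Lemma ract_tcat m n (u : tpow m) (v : tpow n) a :
  ract (tcat u v) a = tcat u (ract v a).
Proof.
elim: m u => [|m IH] u /=; first by rewrite lact_ract.
elim/tpow_ind: u => [|x w u IHu].
  by rewrite !(lin0 (plift_linear _)) (lin0 (ract_linl a)).
rewrite !(linD (plift_linear _)) (linD (ract_linl a)) IHu; congr (_ + _).
by rewrite -!/(tcat (tcons x _ : tpow m.+1) _) !tcat_tcons ract_tcons IH.
Qed.

End TensorPower.

Section Dga.
Variables (K : fieldType) (A : algType K).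

(* A graded family whose degree 0 part is A; [O n] is its part of degree n+1. *)
Definition forms (O : nat -> bimodule A) (n : nat) : bimodule A :=
  if n is m.+1 then O m else regular A.

Definition castf (O : nat -> bimodule A) (m n : nat) (e : m = n)
  (x : forms O m) : forms O n := eq_rect m (fun i => forms O i) x n e.

Inductive generated (O : nat -> bimodule A)
    (wedge : forall m n, forms O m -> forms O n -> forms O (m + n))
    (d : forall n, forms O n -> forms O n.+1) : forall n, forms O n -> Prop :=
| generated_A (a : A) : generated wedge d (a : forms O 0)
| generated_dA (a : A) : generated wedge d (d 0 a)
| generated_lin n c (x y : forms O n) :
    generated wedge d x -> generated wedge d y -> generated wedge d (c *: x + y)
| generated_wedge m n (x : forms O m) (y : forms O n) :
    generated wedge d x -> generated wedge d y ->
    generated wedge d (wedge m n x y).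

Record dga := Dga {
  pforms : nat -> bimodule A;
  wedge : forall m n, forms pforms m -> forms pforms n -> forms pforms (m + n);
  dif : forall n, forms pforms n -> forms pforms n.+1;
  wedge_linl : forall m n (y : forms pforms n), linear (fun x => @wedge m n x y);
  wedge_linr : forall m n (x : forms pforms m), linear (@wedge m n x);
  wedge0n : forall n a (x : forms pforms n), @wedge 0 n a x = lact a x;
  wedgen0 : forall n (x : forms pforms n) a,
    castf (addn0 n) (@wedge n 0 x a) = ract x a;
  wedgeA : forall m n p
      (x : forms pforms m) (y : forms pforms n) (z : forms pforms p),
    castf (addnA m n p) (wedge x (wedge y z)) = wedge (wedge x y) z;
  dif_linear : forall n, linear (@dif n);
  dif_dif : forall n (x : forms pforms n), dif (dif x) = 0;
  dif_wedge : forall m n (x : forms pforms m) (y : forms pforms n),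
    dif (wedge x y) =
      wedge (dif x) y + (-1) ^+ m *: castf (addnS m n) (wedge x (dif y));
  dga_generated : forall n (x : forms pforms n), generated wedge dif x }.

Definition Om (W : dga) (n : nat) : bimodule A := forms (pforms W) n.

Definition d0 (W : dga) (a : A) : Om W 1 := @dif W 0 a.

End Dga.

Section Connection.
Variables (K : fieldType) (A : algType K) (W : dga A).
Local Notation O1 := (Om W 1).
Local Notation O2 := (Om W 2).

Definition bimodule_connection (E : bimodule A)
    (nabla : E -> tensor O1 E) (sigma : tensor E O1 -> tensor O1 E) : Prop :=
  [/\ linear nabla, bimodule_map sigma,
      forall a w, nabla (lact a w) = tmul (d0 W a) w + lact a (nabla w) &
      forall w a, nabla (ract w a) = ract (nabla w) a + sigma (tmul w (d0 W a))].

Variables (nabla : O1 -> tensor O1 O1) (sigma : tensor O1 O1 -> tensor O1 O1).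
Local Notation T := (tpow O1).

(* [braid n i] is sigma in the tensor factors i, i+1 of T n, for 1 <= i < n;
   it is the identity for other values of i. *)
Fixpoint braid (n i : nat) {struct n} : T n -> T n :=
  match n return T n -> T n with
  | 0 => id
  | m.+1 =>
    match i with
    | 0 => id
    | 1 =>
      match m return T m.+1 -> T m.+1 with
      | 0 => id
      | p.+1 => plift (fun (x : O1) => plift (fun (y : O1) (v : T p) =>
                  @tcat K A O1 2 p (sigma (tmul x y)) v : T p.+2))
      end
    | i'.+2 => plift (fun (x : O1) (v : T m) => tcons x (@braid m i'.+1 v))
    end
  end.

Fixpoint nab (n : nat) : T n -> T n.+1 :=
  match n return T n -> T n.+1 with
  | 0 => @d0 K A W
  | m.+1 =>
    match m return (T m -> T m.+1) -> T m.+1 -> T m.+2 with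
    | 0 => fun _ => nabla
    | p.+1 => fun nab_m => plift (fun (x : O1) (v : T p.+1) =>
        (@tcat K A O1 2 p.+1 (nabla x) v : T p.+3) +
        @braid p.+3 1 (tcons x (nab_m v)))
    end (@nab m)
  end.

Fixpoint nabn (n : nat) : A -> T n :=
  if n is m.+1 return A -> T n then fun a => nab (nabn m a) else id.

(* sigma_(m-j) ... sigma_(m-1) on T n *)
Fixpoint bchain (n m j : nat) (t : T n) : T n :=
  if j is j'.+1 then @braid n (m - j) (bchain m j' t) else t.

(* [m, sigma] and [m, sigma]! acting on the first m tensor factors of T n; thus
   the factor [m, sigma]! (x) id is [bfact n m]. *)
Definition bint (n m : nat) (t : T n) : T n := \sum_(j < m) bchain m j t.

Fixpoint bfact (n m : nat) (t : T n) : T n :=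
  if m is m'.+1 then bint m (bfact m' t) else t.

Definition brfact (n : nat) : T n -> T n := @bfact n n.

Definition wedge2 : tensor O1 O1 -> O2 := tlift (@wedge K A W 1 1).

Definition wedge_1 : T 3 -> tensor O2 O1 :=
  tlift (fun (x : O1) => tlift (fun y z : O1 =>
    tmul (@wedge K A W 1 1 x y : O2) z)).

Definition wedge_2 : T 3 -> tensor O1 O2 :=
  tlift (fun (x : O1) (u : tensor O1 O1) => tmul x (wedge2 u)).

Definition wedge_nabla (x y : O1) : tensor O2 O1 :=
  tlift (fun p q : O1 => tmul (@wedge K A W 1 1 x p : O2) q) (nabla y).

(* d (x) id - id /\ nabla; only the difference descends to the tensor product
   over A. *)
Definition curv : tensor O1 O1 -> tensor O2 O1 :=
  tlift (fun x y : O1 => tmul (@dif K A W 1 x : O2) y - wedge_nabla x y).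

Definition torsion_free : Prop := forall w, wedge2 (nabla w) = @dif K A W 1 w.

Definition flat : Prop := forall w, curv (nabla w) = 0.

Definition wedge_compatible : Prop :=
  exists (nabla2 : O2 -> tensor O1 O2) (sigma2 : tensor O2 O1 -> tensor O1 O2),
    bimodule_connection nabla2 sigma2 /\
    forall e w : O1, nabla2 (@wedge K A W 1 1 e w) =
      wedge_2 (@tcat K A O1 2 1 (nabla e) w) +
      wedge_2 (@braid 3 1 (@tcons K A O1 2 e (nabla w))).

Definition extendable : Prop :=
  exists f : tensor O1 O2 -> tensor O2 O1, bimodule_map f /\
    forall w e z : O1, f (tmul w (@wedge K A W 1 1 e z : O2)) =
      wedge_1 (@braid 3 2 (@braid 3 1 (tmul w (tmul e z)))).

Definition leibniz_compatible : Prop :=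
  forall u : T 2, @nab 2 (@braid 2 1 u) = @braid 3 2 (@nab 2 u).

(* The functions lifted above are balanced, so that the lifts are never the
   default 0 (for [braid], [nab] and [curv]: provided that (nabla, sigma) is a
   bimodule connection). *)

Lemma castf_id (O : nat -> bimodule A) n (e : n = n) (x : forms O n) :
  castf e x = x.
Proof. by rewrite (eq_irrelevance e (erefl n)). Qed.

Lemma wedge_balanced : balanced (@wedge K A W 1 1).
Proof.
split=> [y|x|x a y]; [exact: wedge_linl | exact: wedge_linr |].
have := @wedgeA K A W 1 0 1 x a y.
by rewrite castf_id wedge0n -(wedgen0 (x : forms (pforms W) 1) a) castf_id => ->.
Qed.

Lemma wedge2E x y : wedge2 (tmul x y) = @wedge K A W 1 1 x y.
Proof. exact: tliftE wedge_balanced. Qed.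

Lemma wedge_lact a (x y : O1) :
  @wedge K A W 1 1 (lact a x) y = lact a (@wedge K A W 1 1 x y : O2).
Proof.
have := @wedgeA K A W 0 1 1 a x y.
by rewrite castf_id !wedge0n => <-.
Qed.

Lemma wedge_ract a (x y : O1) :
  @wedge K A W 1 1 x (ract y a) = ract (@wedge K A W 1 1 x y : O2) a.
Proof.
have := @wedgeA K A W 1 1 0 x y a.
rewrite castf_id -(wedgen0 (y : forms (pforms W) 1) a) castf_id => ->.
by rewrite -(wedgen0 (@wedge K A W 1 1 x y) a) castf_id.
Qed.

Lemma wedge_1_balanced (x : O1) :
  balanced (fun y z : O1 => tmul (@wedge K A W 1 1 x y : O2) z).
Proof.
have [bl br bb] := @tmul_balanced K A O2 O1.
split=> [z|y|y a z]; last by rewrite wedge_ract bb.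
  by move=> c y y'; rewrite wedge_linr; exact: bl.
exact: br.
Qed.

Lemma wedge_1_linl (u : tensor O1 O1) :
  linear (fun x : O1 => tlift (fun y z : O1 => tmul (@wedge K A W 1 1 x y : O2) z) u).
Proof.
have [bl br bb] := @tmul_balanced K A O2 O1.
move=> c x x'; elim/tensor_ind: u => [|y z u IH].
  by rewrite !(lin0 (tlift_linear _)) scaler0 addr0.
rewrite !(linD (tlift_linear _)) IH scalerDr !(tliftE _ _ (wedge_1_balanced _)).
by rewrite wedge_linl bl -!addrA; congr (_ + _); rewrite addrCA.
Qed.

Lemma wedge_1E x y z :
  wedge_1 (tmul x (tmul y z)) = tmul (@wedge K A W 1 1 x y : O2) z.
Proof.
rewrite /wedge_1 tliftE ?tliftE //; first exact: wedge_1_balanced.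
split=> [u|{}x|{}x a u]; [exact: wedge_1_linl | exact: tlift_linear |].
elim/tensor_ind: u => [|y' z' u IH].
  by rewrite (lin0 (lact_linr a)) !(lin0 (tlift_linear _)).
rewrite (linD (lact_linr a)) !(linD (tlift_linear _)) IH; congr (_ + _).
rewrite lact_tmul !(tliftE _ _ (wedge_1_balanced _)).
by case: wedge_balanced => _ _ ->.
Qed.

Lemma wedge_2E x (u : tensor O1 O1) : wedge_2 (tmul x u) = tmul x (wedge2 u).
Proof.
have [bl br bb] := @tmul_balanced K A O1 O2.
rewrite /wedge_2 tliftE //; split=> [{}u|{}x|{}x a {}u]; first exact: bl.
  by move=> c v v'; rewrite /wedge2 tlift_linear; exact: br.
rewrite bb; congr (tmul x _).
elim/tensor_ind: u => [|y z u IH].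
  by rewrite (lin0 (lact_linr a)) /wedge2 (lin0 (tlift_linear _)) (lin0 (lact_linr a)).
rewrite !(linD (lact_linr a)) /wedge2 !(linD (tlift_linear _)) (linD (lact_linr a)).
by congr (_ + _); rewrite // lact_tmul -!/(wedge2 _) !wedge2E wedge_lact.
Qed.

Lemma braid_linear n i : linear (@braid n i).
Proof.
by case: n i => [|[|n]] [|[|i]]; try exact: id_lin; exact: plift_linear.
Qed.

Lemma bchain_linear n m j : linear (@bchain n m j).
Proof.
elim: j => [|j IH]; first exact: id_lin.
by move=> c u v; rewrite /= IH braid_linear.
Qed.

Lemma bint_linear n m : linear (@bint n m).
Proof.
move=> c u v; rewrite /bint scaler_sumr -big_split; apply: eq_bigr => j _.
exact: bchain_linear.
Qed.

Lemma bfact_linear n m : linear (@bfact n m).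
Proof.
elim: m => [|m IH]; first exact: id_lin.
by move=> c u v; rewrite /= IH bint_linear.
Qed.

Lemma brfact_linear n : linear (@brfact n).
Proof. exact: bfact_linear. Qed.

Section Guards.
Hypothesis conn : bimodule_connection nabla sigma.

Lemma dif_ract a (x : O1) : (@dif K A W 1 (ract x a) : O2) =
  ract (@dif K A W 1 x : O2) a - @wedge K A W 1 1 x (d0 W a).
Proof.
have := @dif_wedge K A W 1 0 x a.
rewrite castf_id -(wedgen0 (x : forms (pforms W) 1) a) castf_id expr1 scaleN1r => ->.
by rewrite -(wedgen0 (@dif K A W 1 x) a) castf_id.
Qed.

Lemma curvE x y :
  curv (tmul x y) = tmul (@dif K A W 1 x : O2) y - wedge_nabla x y.
Proof.
have [nl sb nL nR] := conn.
have [bl br bb] := @tmul_balanced K A O2 O1.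
rewrite /curv tliftE //; split=> [{}y|{}x|{}x a {}y].
- move=> c x1 x2; rewrite dif_linear bl /wedge_nabla wedge_1_linl.
  by rewrite scalerBr opprD addrACA.
- move=> c y1 y2; rewrite br /wedge_nabla nl tlift_linear.
  by rewrite scalerBr opprD addrACA.
- rewrite dif_ract (linD (bl y)) (linN (bl y)) bb -addrA -opprD /wedge_nabla.
  congr (_ - _); rewrite nL (linD (tlift_linear _)).
  rewrite (tliftE _ _ (wedge_1_balanced _)); congr (_ + _).
  elim/tensor_ind: (nabla y) => [|p q u IH].
    by rewrite (lin0 (lact_linr a)) !(lin0 (tlift_linear _)).
  rewrite (linD (lact_linr a)) !(linD (tlift_linear _)) IH; congr (_ + _).
  rewrite lact_tmul !(tliftE _ _ (wedge_1_balanced _)).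
  by case: wedge_balanced => _ _ ->.
Qed.

Lemma sigma_linear : linear sigma.
Proof. by case: conn => _ [_ H _ _] _ _ c u v; exact: H. Qed.
Lemma sigma_lact a u : sigma (lact a u) = lact a (sigma u).
Proof. by case: conn => _ [_ _ H _] _ _; exact: H. Qed.
Lemma sigma_ract u a : sigma (ract u a) = ract (sigma u) a.
Proof. by case: conn => _ [_ _ _ H] _ _; exact: H. Qed.

Lemma braid1_balanced p (x : O1) :
  balanced (fun (y : O1) (v : T p) =>
              @tcat K A O1 2 p (sigma (tmul x y)) v : T p.+2).
Proof.
have [bl br bb] := @tmul_balanced K A O1 O1.
split=> [v|y|y a v].
- by move=> c y y'; rewrite br sigma_linear; exact: (@tcat_linl K A O1 2 p v).
- exact: (@tcat_linr K A O1 2 p).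
- by rewrite -ract_tmul sigma_ract; exact: (@tcat_bal K A O1 2 p).
Qed.

Lemma braid1_balanced2 p :
  balanced (fun (x : O1) => plift (fun (y : O1) (v : T p) =>
                  @tcat K A O1 2 p (sigma (tmul x y)) v : T p.+2)).
Proof.
have [bl br bb] := @tmul_balanced K A O1 O1.
have E x y (v : T p) := pliftE y v (@braid1_balanced p x).
split=> [u|x|x a u]; last 2 first.
- exact: plift_linear.
- elim/tpow_ind: u => [|y v u IH].
    by rewrite (lin0 (lact_linr a)) !(lin0 (plift_linear _)).
  rewrite (linD (lact_linr a)) !(linD (plift_linear _)) IH; congr (_ + _).
  by rewrite lact_tcons !E bb.
- move=> c x x'; elim/tpow_ind: u => [|y v u IH].
    by rewrite !(lin0 (plift_linear _)) scaler0 addr0.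
  rewrite !(linD (plift_linear _)) IH scalerDr !E.
  rewrite bl sigma_linear (@tcat_linl K A O1 2 p) -!addrA.
  by congr (_ + _); rewrite addrCA.
Qed.

Lemma braid1E p (x y : O1) (v : T p) :
  @braid p.+2 1 (tcons x (tcons y v)) = @tcat K A O1 2 p (sigma (tmul x y)) v.
Proof.
have E1 := pliftE y v (@braid1_balanced p x).
have E2 := pliftE (n := p.+1) x (tcons y v) (@braid1_balanced2 p).
exact: (etrans E2 E1).
Qed.

Lemma braid_lact_balanced n i :
  (forall a (u : T n), braid i (lact a u) = lact a (braid i u)) /\
  (forall j, i = j.+1 ->
     balanced (fun (x : O1) (v : T n) => tcons x (@braid n j.+1 v))).
Proof.
suff H : forall j, forall a (u : T n), braid j (lact a u) = lact a (braid j u).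
  split; first exact: H.
  move=> j _; have [bl br bb] := @tcons_balanced K A O1 n.
  split=> [v|x|x a v]; [exact: bl | | by rewrite H bb].
  by move=> c v v'; rewrite braid_linear; exact: br.
elim: n {i} => [|n IH] [|[|j]] a //.
- case: n IH => [|p] _ u //.
  elim/tpow_ind: u => [|x v u IHu].
    by rewrite (lin0 (lact_linr a)) !(lin0 (@braid_linear _ _)) (lin0 (lact_linr a)).
  rewrite (linD (lact_linr a)) !(linD (@braid_linear _ _)) (linD (lact_linr a)).
  rewrite IHu; congr (_ + _); rewrite lact_tcons.
  elim/tpow_ind: v => [|y v w IHv].
    have [_ br _] := @tcons_balanced K A O1 p.+1.
    by rewrite !(lin0 (br _)) !(lin0 (@braid_linear _ _)) (lin0 (lact_linr a)).
  have [_ br _] := @tcons_balanced K A O1 p.+1.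
  rewrite !(linD (br _)) !(linD (@braid_linear _ _)) (linD (lact_linr a)) IHv.
  congr (_ + _); rewrite !braid1E -lact_tmul sigma_lact.
  by rewrite -(@lact_tcat K A O1 2 p).
- move=> u.
  have bal : balanced (fun (x : O1) (v : T n) => tcons x (@braid n j.+1 v)).
    have [bl br bb] := @tcons_balanced K A O1 n.
    split=> [v|x|x b v]; [exact: bl | | by rewrite IH bb].
    by move=> c v v'; rewrite braid_linear; exact: br.
  elim/tpow_ind: u => [|x v u IHu].
    by rewrite (lin0 (lact_linr a)) !(lin0 (@braid_linear _ _)) (lin0 (lact_linr a)).
  rewrite (linD (lact_linr a)) !(linD (@braid_linear _ _)) (linD (lact_linr a)).
  rewrite IHu; congr (_ + _); rewrite lact_tcons /=.
  by rewrite !(pliftE _ _ bal) lact_tcons.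
Qed.

Lemma braid_lact n i a (u : T n) : braid i (lact a u) = lact a (braid i u).
Proof. by case: (braid_lact_balanced n i). Qed.

Lemma braidSE n i (x : O1) (v : T n) :
  @braid n.+1 i.+2 (tcons x v) = tcons x (@braid n i.+1 v).
Proof.
case: (braid_lact_balanced n i.+1) => _ /(_ i erefl) bal.
exact: pliftE bal.
Qed.

Lemma nab_balanced_lact n :
  [/\ linear (@nab n),
      forall a (v : T n), nab (lact a v) = tcons (d0 W a) v + lact a (nab v) &
      balanced (fun (x : O1) (v : T n) =>
        (@tcat K A O1 2 n (nabla x) v : T n.+2) +
        @braid n.+2 1 (tcons x (nab v)))].
Proof.
have [nl sb nL nR] := conn.
suff H : linear (@nab n) /\
    forall a (v : T n), nab (lact a v) = tcons (d0 W a) v + lact a (nab v).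
  case: H => Hl HL; split=> //.
  have [bl br bb] := @tcons_balanced K A O1 n.+1.
  have [bl' br' bb'] := @tmul_balanced K A O1 O1.
  split=> [v|x|x a v].
  - move=> c x x'; rewrite nl (@tcat_linl K A O1 2 n) bl braid_linear.
    by rewrite scalerDr addrACA.
  - move=> c v v'; rewrite (@tcat_linr K A O1 2 n) Hl br braid_linear.
    by rewrite scalerDr addrACA.
  - rewrite HL (linD (br x)) (linD (@braid_linear _ _)) braid1E bb addrA.
    congr (_ + _); rewrite nR (linD (@tcat_linl K A O1 2 n v)).
    by congr (_ + _); exact: (@tcat_bal K A O1 2 n).
elim: n => [|n [Hl HL]].
  split; first exact: (@dif_linear K A W 0).
  move=> a b.
  have := @dif_wedge K A W 0 0 a b.
  rewrite castf_id expr0 scale1r !wedge0n => E.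
  have Ew : @wedge K A W 1 0 (d0 W a) b = ract (d0 W a) b :> O1.
    by rewrite -(wedgen0 (d0 W a) b) castf_id.
  exact: (etrans E (congr1 (fun z : O1 => z + lact a (d0 W b)) Ew)).
case: n Hl HL => [|p] Hl HL; first by split=> //; exact: nL.
have bal : balanced (fun (x : O1) (v : T p.+1) =>
        (@tcat K A O1 2 p.+1 (nabla x) v : T p.+3) +
        @braid p.+3 1 (tcons x (nab v))).
  have [bl br bb] := @tcons_balanced K A O1 p.+2.
  split=> [v|x|x a v].
  - move=> c x x'; rewrite nl (@tcat_linl K A O1 2 p.+1) bl braid_linear.
    by rewrite scalerDr addrACA.
  - move=> c v v'; rewrite (@tcat_linr K A O1 2 p.+1) Hl br braid_linear.
    by rewrite scalerDr addrACA.
  - rewrite HL (linD (br x)) (linD (@braid_linear _ _)) braid1E bb addrA.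
    congr (_ + _); rewrite nR (linD (@tcat_linl K A O1 2 p.+1 v)).
    by congr (_ + _); exact: (@tcat_bal K A O1 2 p.+1).
have Lin : linear (@nab p.+2) by exact: plift_linear.
have E x v := pliftE x v bal.
split; first exact: Lin.
move=> a u; elim/tpow_ind: u => [|x v u IH].
  have [_ br _] := @tcons_balanced K A O1 p.+2.
  rewrite (lin0 (lact_linr a)) !(lin0 Lin) (lin0 (br _)).
  by rewrite (lin0 (lact_linr a)) addr0.
have [bl br bb] := @tcons_balanced K A O1 p.+2.
rewrite (linD (lact_linr a)) !(linD Lin) (linD (br _)).
rewrite (linD (lact_linr a)) addrACA; congr (_ + _); last exact: IH.
rewrite lact_tcons [LHS]E; transitivity
  (tcons (d0 W a) (tcons x v) + lact a ((@tcat K A O1 2 p.+1 (nabla x) v : T p.+3) +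
        @braid p.+3 1 (tcons x (nab v)))); last by congr (_ + lact a _); rewrite -E.
rewrite nL (linD (lact_linr a)) addrA.
rewrite (linD (@tcat_linl K A O1 2 p.+1 v)) -!addrA.
congr (_ + (_ + _)).
- exact: tcat2.
- by rewrite (@lact_tcat K A O1 2 p.+1).
- by rewrite -braid_lact lact_tcons.
Qed.

Lemma nab_linear n : linear (@nab n).
Proof. by case: (nab_balanced_lact n). Qed.

Lemma nab_lact n a (v : T n) :
  nab (lact a v) = tcons (d0 W a) v + lact a (nab v).
Proof. by case: (nab_balanced_lact n). Qed.

Lemma nabE n (x : O1) (v : T n.+1) :
  nab (tcons x v) = (@tcat K A O1 2 n.+1 (nabla x) v : T n.+3) +
                    @braid n.+3 1 (tcons x (nab v)).
Proof. by case: (nab_balanced_lact n.+1) => _ _ bal; exact: pliftE bal. Qed.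

End Guards.

End Connection.

Section KerQuotient.
Variables (K : fieldType) (V V' : lmodType K) (F : V -> V').
Hypothesis lF : linear F.

Definition kereq (u v : V) : bool := F u == F v.

Lemma kereq_equiv : equiv_class_of kereq.
Proof.
split=> [u|u v|v u w]; rewrite /kereq; [exact: eqxx | exact: eq_sym |].
by move=> /eqP -> /eqP ->.
Qed.

Canonical kereq_equivRel := EquivRelPack kereq_equiv.

Definition kerquot of linear F := {eq_quot kereq}.
Local Notation Q := (kerquot lF).
HB.instance Definition _ := Choice.on Q.
HB.instance Definition _ := EqQuotient.on Q.

Definition kpi (u : V) : Q := \pi_Q u.
Definition krepr (x : Q) : V := repr x.

Lemma kpiW (P : Q -> Prop) : (forall u, P (kpi u)) -> forall x, P x.
Proof. by move=> H x; rewrite -[x]reprK; exact: H. Qed.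

Lemma kpi_eq u v : kpi u = kpi v <-> F u = F v.
Proof. by split=> [/eqmodP/eqP|uv] //; apply/eqmodP/eqP. Qed.

Lemma F_krepr u : F (krepr (kpi u)) = F u.
Proof. by apply/kpi_eq; rewrite /kpi /krepr reprK. Qed.

Definition kadd (x y : Q) : Q := kpi (krepr x + krepr y).
Definition kopp (x : Q) : Q := kpi (- krepr x).
Definition kscale (c : K) (x : Q) : Q := kpi (c *: krepr x).

Lemma kaddE u v : kadd (kpi u) (kpi v) = kpi (u + v).
Proof. by apply/kpi_eq; rewrite !(linD lF) !F_krepr. Qed.
Lemma koppE u : kopp (kpi u) = kpi (- u).
Proof. by apply/kpi_eq; rewrite !(linN lF) !F_krepr. Qed.
Lemma kscaleE c u : kscale c (kpi u) = kpi (c *: u).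
Proof. by apply/kpi_eq; rewrite !(linZ lF) !F_krepr. Qed.

Lemma kaddA : associative kadd.
Proof. by elim/kpiW=> u; elim/kpiW=> v; elim/kpiW=> w; rewrite !kaddE addrA. Qed.
Lemma kaddC : commutative kadd.
Proof. by elim/kpiW=> u; elim/kpiW=> v; rewrite !kaddE addrC. Qed.
Lemma kadd0 : left_id (kpi 0) kadd.
Proof. by elim/kpiW=> u; rewrite kaddE add0r. Qed.
Lemma kaddN : left_inverse (kpi 0) kopp kadd.
Proof. by elim/kpiW=> u; rewrite koppE kaddE addNr. Qed.

HB.instance Definition _ := GRing.isZmodule.Build Q kaddA kaddC kadd0 kaddN.

Lemma kscaleA b c x : kscale b (kscale c x) = kscale (b * c) x.
Proof. by move: x; elim/kpiW=> u; rewrite !kscaleE scalerA. Qed.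
Lemma kscale1 : left_id 1 kscale.
Proof. by elim/kpiW=> u; rewrite kscaleE scale1r. Qed.
Lemma kscaleDr : right_distributive kscale +%R.
Proof.
move=> c; elim/kpiW=> u; elim/kpiW=> v.
by rewrite [_ + _]kaddE !kscaleE [RHS]kaddE scalerDr.
Qed.
Lemma kscaleDl x : {morph kscale^~ x : b c / b + c}.
Proof.
by move=> b c; move: x; elim/kpiW=> u; rewrite !kscaleE [RHS]kaddE scalerDl.
Qed.

HB.instance Definition _ := GRing.Zmodule_isLmodule.Build K Q
  kscaleA kscale1 kscaleDr kscaleDl.

Lemma kpi_linear : linear kpi.
Proof. by move=> c u v; rewrite [c *: kpi u]kscaleE [RHS]kaddE. Qed.

Definition kinj (x : Q) : V' := F (krepr x).

Lemma kinjE u : kinj (kpi u) = F u. Proof. exact: F_krepr. Qed.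

Lemma kinj_inj : injective kinj.
Proof. by elim/kpiW=> u; elim/kpiW=> v; rewrite !kinjE => /kpi_eq. Qed.

End KerQuotient.

Section DirectSum.
Variables (K : fieldType) (V : nat -> lmodType K).

Record dsum := DSum {
  dsf :> forall n, V n;
  dsP : exists N, forall n, (N <= n)%N -> dsf n = 0 }.

HB.instance Definition _ := gen_eqMixin dsum.
HB.instance Definition _ := gen_choiceMixin dsum.

Lemma dsum_eq (x y : dsum) : (forall n, x n = y n) -> x = y.
Proof.
case: x y => [f fP] [g gP] /= fg.
have {}fg : f = g by apply: functional_extensionality_dep.
by case: _ / fg gP => gP; congr DSum; exact: Prop_irrelevance.
Qed.

Lemma dsum0P : exists N, forall n, (N <= n)%N -> (0 : V n) = 0.
Proof. by exists 0. Qed.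
Definition dsum0 := DSum dsum0P.

Lemma dsumDP (x y : dsum) : exists N, forall n, (N <= n)%N -> x n + y n = 0.
Proof.
have [[N xN] [N' yN]] := (dsP x, dsP y).
exists (maxn N N') => n; rewrite geq_max => /andP[/xN -> /yN ->].
exact: addr0.
Qed.
Definition dsumD (x y : dsum) := DSum (dsumDP x y).

Lemma dsumNP (x : dsum) : exists N, forall n, (N <= n)%N -> - x n = 0.
Proof. by have [N xN] := dsP x; exists N => n /xN ->; rewrite oppr0. Qed.
Definition dsumN (x : dsum) := DSum (dsumNP x).

Lemma dsumZP c (x : dsum) : exists N, forall n, (N <= n)%N -> c *: x n = 0.
Proof. by have [N xN] := dsP x; exists N => n /xN ->; rewrite scaler0. Qed.
Definition dsumZ c (x : dsum) := DSum (dsumZP c x).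

Lemma dsumDA : associative dsumD.
Proof. by move=> x y z; apply: dsum_eq => n; exact: addrA. Qed.
Lemma dsumDC : commutative dsumD.
Proof. by move=> x y; apply: dsum_eq => n; exact: addrC. Qed.
Lemma dsumD0 : left_id dsum0 dsumD.
Proof. by move=> x; apply: dsum_eq => n; exact: add0r. Qed.
Lemma dsumDN : left_inverse dsum0 dsumN dsumD.
Proof. by move=> x; apply: dsum_eq => n; exact: addNr. Qed.

HB.instance Definition _ := GRing.isZmodule.Build dsum
  dsumDA dsumDC dsumD0 dsumDN.

Lemma dsumZA b c x : dsumZ b (dsumZ c x) = dsumZ (b * c) x.
Proof. by apply: dsum_eq => n; exact: scalerA. Qed.
Lemma dsumZ1 : left_id 1 dsumZ.
Proof. by move=> x; apply: dsum_eq => n; exact: scale1r. Qed.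
Lemma dsumZDr : right_distributive dsumZ +%R.
Proof. by move=> c x y; apply: dsum_eq => n; exact: scalerDr. Qed.
Lemma dsumZDl x : {morph dsumZ^~ x : b c / b + c}.
Proof. by move=> b c; apply: dsum_eq => n; exact: scalerDl. Qed.

HB.instance Definition _ := GRing.Zmodule_isLmodule.Build K dsum
  dsumZA dsumZ1 dsumZDr dsumZDl.

Definition dinjf (i : nat) (v : V i) (n : nat) : V n :=
  match @eqP _ i n with
  | ReflectT e => eq_rect i (fun m => V m) v n e
  | ReflectF _ => 0
  end.

Lemma dinjP i (v : V i) : exists N, forall n, (N <= n)%N -> dinjf v n = 0.
Proof.
exists i.+1 => n lt_in; rewrite /dinjf; case: eqP => // e.
by exfalso; move: lt_in; rewrite e ltnn.
Qed.

Definition dinj i (v : V i) : dsum := DSum (dinjP v).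

Lemma dinj_id i (v : V i) : dinj v i = v.
Proof.
by rewrite /= /dinjf; case: eqP => // e; rewrite (eq_irrelevance e erefl).
Qed.

Lemma dinj_neq i n (v : V i) : i <> n -> dinj v n = 0.
Proof. by rewrite /= /dinjf; case: eqP. Qed.

Definition dbound (x : dsum) : nat := sval (cid (dsP x)).

Lemma dboundP (x : dsum) n : (dbound x <= n)%N -> x n = 0.
Proof. by rewrite /dbound; case: cid => N /= H; exact: H. Qed.

End DirectSum.

Section Jets.
Variables (K : fieldType) (A : algType K) (W : dga A).
Local Notation O1 := (Om W 1).
Local Notation T := (tpow O1).
Variable sigma : tensor O1 O1 -> tensor O1 O1.

Definition Sdeg (n : nat) : lmodType K := kerquot (@brfact_linear K A W sigma n).

Definition Sproj (n : nat) : T n -> Sdeg n := @kpi _ _ _ _ (@brfact_linear K A W sigma n).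

(* [n, sigma]! as a map defined on S^n *)
Definition Sfact (n : nat) : Sdeg n -> T n := @kinj _ _ _ _ (@brfact_linear K A W sigma n).

Definition Salg : lmodType K := dsum Sdeg.

(* [krepr] picks a representative; that the product of classes does not depend
   on it amounts to the kernels of the [n, sigma]! forming a two-sided ideal. *)
Definition Smulh (m n : nat) (x : Sdeg m) (y : Sdeg n) : Sdeg (m + n) :=
  Sproj (tcat (krepr x) (krepr y)).

Definition Smul (x y : Salg) : Salg :=
  \sum_(i < dbound x) \sum_(j < dbound y) dinj (Smulh (dsf x i) (dsf y j)).

Definition Jet (k : nat) : set Salg :=
  [set w : Salg | forall n, (k < n)%N -> dsf w n = 0].

Variable d : forall i, A -> Sdeg i.

Definition jet (k : nat) (a : A) : Salg := \sum_(i < k.+1) dinj (d i a).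

Definition jet_lact (k : nat) (a : A) (w : Salg) : Salg :=
  \sum_(j < k.+1) Smul (jet (k - j) a) (dinj (dsf w j)).

Definition jet_ract (k : nat) (w : Salg) (a : A) : Salg :=
  \sum_(j < k.+1) Smul (dinj (dsf w j)) (jet (k - j) a).

End Jets.

Arguments Sproj {K A W} sigma {n} u.
Arguments Sfact {K A W sigma n} x.
Arguments Jet {K A W} sigma k.

Definition jet_trunc (K : fieldType) (A : algType K) (W : dga A)
    (sigma : tensor (Om W 1) (Om W 1) -> tensor (Om W 1) (Om W 1))
    (k : nat) (w : Salg sigma) : Salg sigma :=
  \sum_(j < k) dinj (dsf w j).

(* Main.v *)
From HB Require Import structures.
Require Import Defs.
From mathcomp Require Import all_boot all_order all_algebra.
From mathcomp Require Import boolp classical_sets.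
From mathcomp Require Import zify.

Set Implicit Arguments.
Unset Strict Implicit.
Unset Printing Implicit Defensive.

Import GRing.Theory.
Local Open Scope ring_scope.
Local Open Scope classical_set_scope.

(** The jet bimodule is the braided-symmetric algebra modulo degrees above k,
    with A acting through the map [jet d k]. Since truncation is a quotient by an
    ideal ([tr_mull], [tr_mulr]), and since the two actions are truncated products
    with the jet of order k ([jet_lactE], [jet_ractE]), everything follows from
    three facts: the braided-symmetric algebra is an associative unital algebra,
    the jet of 1 is 1, and the jet of a b is the truncated product of the jets of
    a and b.

    Both the first and the last fact rest on a factorization of braided factorials
    ([bfac_add]): [m + n]! is a braided binomial coefficient times
    [m]! (x) [n]!, because a permutation is a shuffle of permutations of two
    blocks. It holds in any ring with elements satisfying the braid relations. Its
    first consequence is that the kernels of the factorials form an ideal, so that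
    the product of classes is well defined ([Sproj_tcat]).

    The jet rule comes from a higher Leibniz rule for the iterated connection
    ([nabn_mul]): nabla^n (a b) is the sum over i of the binomial coefficient
    applied to nabla^i a (x) nabla^(n-i) b. It is proved like the binomial
    theorem. The connection differentiates u (x) v by differentiating u, plus
    differentiating v and braiding the new one-form across u ([nabA_tcat]); it
    intertwines the braiding of factors i, i + 1 with that of i + 1, i + 2
    ([nabA_sgen]); and the binomial coefficients obey the matching Pascal rule.
    Writing nabla^i a as [i]! (d^i a), the factorization turns the sum into
    [n]! applied to the sum of the products d^i a d^(n-i) b, and [n]! is injective
    on the quotient ([jet_coef_mul]).

    The braid relations themselves are a consequence of Leibniz compatibility
    ([braid3]). *)

(** * Braided factorials and binomials in a ring *)

Definition shift (R : Type) (p : nat) (s : nat -> R) : nat -> R :=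
  fun i => s (p + i)%N.

Section BraidedFactorial.
Variable R : pzRingType.
Implicit Type s : nat -> R.

Definition braided s : Prop :=
  (forall i j, (i.+1 < j)%N -> s i * s j = s j * s i) /\
  (forall i, s i * s i.+1 * s i = s i.+1 * s i * s i.+1).

Lemma braided_shift p s : braided s -> braided (shift p s).
Proof.
case=> far rel; split=> [i j lt_ij|i]; rewrite /shift; first by apply: far; lia.
by rewrite addnS; exact: rel.
Qed.

Fixpoint run s n : R := if n is n'.+1 then run s n' * s n' else 1.

(** The braided integer [n]. Apart from its longest chain [run s n], the terms
    of [n + 1] are those of [n] moved one strand to the right. *)
Fixpoint bnum s n : R := if n is n'.+1 then bnum (shift 1 s) n' + run s n' else 0.

Fixpoint bfac s n : R := if n is n'.+1 then bnum s n * bfac s n' else 1.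

(** Where [bnum s n] moves the last of [n] strands to an arbitrary place,
    [dnum s n] moves a strand from an arbitrary place to the front. *)
Definition dnum s n : R := \sum_(j < n) run s j.

(** The braided binomial coefficient, the sum of the positive braids that
    shuffle [i] strands with the [n - i] strands after them. Pascal's rule asks
    for the origin of the strand that ends up in front: either it is the first of
    the [i] strands, or it belongs to the other block and has crossed all [i] of
    them, which is [run s i]. *)
Fixpoint bbin s n i : R :=
  match n, i with
  | _, 0 => 1
  | 0, _.+1 => 0
  | n'.+1, i'.+1 => bbin (shift 1 s) n' i' + bbin (shift 1 s) n' i * run s i
  end.

Lemma shiftE p q s : shift p (shift q s) = shift (p + q) s.
Proof. by apply/funext => i; rewrite /shift addnA (addnC p). Qed.

Lemma shift0 s : shift 0 s = s. Proof. by []. Qed.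

Lemma runSl s n : run s n.+1 = s 0%N * run (shift 1 s) n.
Proof. by elim: n => [|n IH]; rewrite /= ?mul1r ?mulr1 // mulrA -IH. Qed.

Lemma run_add s m n : run s (m + n) = run s m * run (shift m s) n.
Proof. by elim: n => [|n IH]; rewrite ?addn0 ?mulr1 // addnS /= IH mulrA. Qed.

Lemma bnumE s n : bnum s n = \sum_(j < n) run (shift (n - j.+1) s) j.
Proof.
elim: n s => [|n IH] s; first by rewrite big_ord0.
rewrite big_ord_recr /= subnn shift0 IH; congr (_ + _); apply: eq_bigr => j _.
by rewrite shiftE addn1 -subSn ?ltn_ord.
Qed.

(** For [s' = s] this says that an element commuting with the generators
    commutes with the chain; for [s' = shift 1 s] it moves the chain past an
    element that relabels the strands. The same holds for [bnum], [bfac] and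
    [bbin] below. *)
Lemma run_intertwine s s' c n :
  (forall i, (i < n)%N -> s' i * c = c * s i) -> run s' n * c = c * run s n.
Proof.
elim: n => [|n IH] H; first by rewrite mul1r mulr1.
rewrite /= -mulrA H // mulrA IH ?mulrA // => i lt_in.
exact/H/ltnW.
Qed.

Lemma bnum_intertwine s s' c n :
  (forall i, (i.+1 < n)%N -> s' i * c = c * s i) -> bnum s' n * c = c * bnum s n.
Proof.
elim: n s s' => [|n IH] s s' H; first by rewrite mul0r mulr0.
rewrite /= mulrDl mulrDr (IH (shift 1 s)) => [|i lt_in]; last by apply: H; lia.
by congr (_ + _); apply: run_intertwine => i lt_in; apply: H; lia.
Qed.

Lemma bfac_intertwine s s' c n :
  (forall i, (i.+1 < n)%N -> s' i * c = c * s i) -> bfac s' n * c = c * bfac s n.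
Proof.
elim: n => [|n IH] H; first by rewrite mul1r mulr1.
rewrite [bfac s' _]/= [bfac s _]/= -/(bnum s' n.+1) -/(bnum s n.+1).
rewrite -mulrA IH => [|i lt_in]; last by apply: H; lia.
by rewrite !mulrA (bnum_intertwine H).
Qed.

Lemma bbin0 s n : bbin s n 0 = 1. Proof. by case: n. Qed.

Lemma bbin_intertwine s s' c n i :
  (forall j, s' j * c = c * s j) -> bbin s' n i * c = c * bbin s n i.
Proof.
elim: n i s s' => [|n IH] [|i] s s' H; rewrite ?bbin0 ?mul1r ?mulr1 //=.
  by rewrite mul0r mulr0.
rewrite mulrDl mulrDr -mulrA.
rewrite [X in _ + _ * X](run_intertwine (s := s) (n := i.+1)) // mulrA.
by rewrite !(IH _ (shift 1 s)) ?mulrA // => j; exact: H.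
Qed.

Lemma dnumS s n : dnum s n.+1 = dnum s n + run s n.
Proof. by rewrite /dnum big_ord_recr. Qed.

Lemma dnum_add s m n : dnum s (m + n) = dnum s m + run s m * dnum (shift m s) n.
Proof.
elim: n => [|n IH]; first by rewrite addn0 /dnum big_ord0 mulr0 addr0.
by rewrite addnS !dnumS IH mulrDr -addrA -run_add.
Qed.

Lemma far_run s p m : braided s -> (m < p)%N -> s p * run s m = run s m * s p.
Proof.
case=> far _ lt_mp; apply/esym; apply: run_intertwine => i lt_im.
by apply: far; lia.
Qed.

Lemma far_dnum s p m : braided s -> (m <= p)%N -> s p * dnum s m = dnum s m * s p.
Proof.
move=> bs le_mp; apply: commr_sum => j _; apply: far_run => //.
by apply: leq_trans (ltn_ord j) le_mp.
Qed.

(** The chain [run s m.+1] takes strand [m.+1] across the strands [0..m], whose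
    labels grow by one; a crossing of two of these strands slides through it. *)
Lemma slide_run s i m : braided s -> (i < m)%N ->
  s i.+1 * run s m.+1 = run s m.+1 * s i.
Proof.
move=> bs lt_im; have [far rel] := bs.
rewrite (_ : m.+1 = i + 2 + (m - i.+1))%N; last by lia.
rewrite !run_add /= mul1r /shift addn0 addn1 -!mulrA.
rewrite [run _ _ * s i](run_intertwine (s := shift (i + 2) s) (s' := shift (i + 2) s)).
  by rewrite !mulrA far_run // -!mulrA; congr (_ * _); rewrite !mulrA rel.
by move=> j _; apply/esym/far; rewrite /shift; lia.
Qed.

Lemma bfac_slide s m : braided s ->
  bfac (shift 1 s) m * run s m = run s m * bfac s m.
Proof.
case: m => [|m] bs; first by rewrite mul1r.
by apply: bfac_intertwine => i; rewrite ltnS; exact: slide_run.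
Qed.

(** [bfac] sums the positive lifts of all permutations, built by placing the last
    strand; this is the same sum, built by choosing the first one. *)
Lemma bfacSr s n : braided s -> bfac s n.+1 = bfac (shift 1 s) n * dnum s n.+1.
Proof.
elim: n s => [|n IH] s bs.
  by rewrite /dnum big_ord1 /= add0r.
rewrite dnumS mulrDr bfac_slide //.
rewrite -[bfac s n.+2]/((bnum (shift 1 s) n.+1 + run s n.+1) * bfac s n.+1).
rewrite mulrDl; congr (_ + _).
by rewrite (IH s bs) mulrA.
Qed.

Lemma bbin_gt s n i : (n < i)%N -> bbin s n i = 0.
Proof.
elim: n i s => [|n IH] [|i] s //= lt_ni.
by rewrite !IH ?mul0r ?addr0 //; lia.
Qed.

Lemma bbinn s n : bbin s n n = 1.
Proof. by elim: n s => //= n IH s; rewrite IH bbin_gt // mul0r addr0. Qed.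

(** Every permutation of [m + n] strands is uniquely a permutation of each block
    followed by a shuffle, and lengths add up. The induction splits the braided
    factorial with [bfacSr] according to the block of the strand that comes first;
    the two cases are the two terms of Pascal's rule. *)
Theorem bfac_add s m n : braided s ->
  bfac s (m + n) = bbin s (m + n) m * bfac s m * bfac (shift m s) n.
Proof.
have [N] := ubnP (m + n)%N; elim: N => // N IH in s m n *.
case: m => [|m] lt_N bs; first by rewrite bbin0 !mul1r shift0.
case: n => [|n] in lt_N *; first by rewrite addn0 bbinn mul1r mulr1.
have bs1 := braided_shift 1 bs.
rewrite addSn bfacSr // -[(m + n.+1).+1]addSn dnum_add mulrDr.
rewrite addSn -[bbin s _ _]/(bbin (shift 1 s) (m + n.+1) m +
  bbin (shift 1 s) (m + n.+1) m.+1 * run s m.+1) !mulrDl.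
have comm_dnum : bfac (shift m.+1 s) n.+1 * dnum s m.+1 =
    dnum s m.+1 * bfac (shift m.+1 s) n.+1.
  by apply: bfac_intertwine => i _; rewrite [shift _ _ _]/shift far_dnum //; lia.
have comm_run : bfac (shift m.+2 s) n * run s m.+1 =
    run s m.+1 * bfac (shift m.+2 s) n.
  by apply: bfac_intertwine => i _; rewrite [shift _ _ _]/shift far_run //; lia.
congr (_ + _).
  rewrite IH // shiftE addn1 (bfacSr m bs) -mulrA comm_dnum.
  by rewrite mulrA -[X in X * _ = _]mulrA.
rewrite addnS -addSn IH //; last by lia.
rewrite shiftE addn1 (bfacSr n (braided_shift m.+1 bs)) shiftE add1n.
have /esym slide := bfac_slide m.+1 bs.
move: (run s m.+1) (bfac s m.+1) (bfac (shift 1 s) m.+1) (bfac _ n) slide comm_run.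
move=> r F F1 F2 slide comm_run.
by rewrite -[X in _ = X * _]mulrA slide -!mulrA (mulrA F2) comm_run !mulrA.
Qed.

End BraidedFactorial.

(** * Endomorphisms and linear maps out of a direct sum *)

Section Endomorphisms.
Variables (K : fieldType) (V : lmodType K).

(** Operators form a ring, so that the braid identities above apply to them as
    identities of ring elements. *)
Record endo := Endo { endo_fun :> V -> V; endo_lin : linear endo_fun }.

HB.instance Definition _ := gen_eqMixin endo.
HB.instance Definition _ := gen_choiceMixin endo.

Lemma endo_eq (f g : endo) : f =1 g -> f = g.
Proof.
case: f g => [f lf] [g lg] /= /funext fg.
by case: _ / fg lg => lg; congr Endo; exact: Prop_irrelevance.
Qed.

Fact endo0_lin : linear (fun _ : V => 0 : V).
Proof. by move=> c x y; rewrite scaler0 addr0. Qed.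
Fact endoN_lin (f : endo) : linear (fun x => - f x).
Proof. by move=> c x y; rewrite endo_lin opprD scalerN. Qed.
Fact endoD_lin (f g : endo) : linear (fun x => f x + g x).
Proof. by move=> c x y; rewrite !endo_lin scalerDr addrACA. Qed.
Fact endoM_lin (f g : endo) : linear (fun x => f (g x)).
Proof. by move=> c x y; rewrite !endo_lin. Qed.

Fact endoDA : associative (fun f g => Endo (endoD_lin f g)).
Proof. by move=> f g h; apply: endo_eq => x; exact: addrA. Qed.
Fact endoDC : commutative (fun f g => Endo (endoD_lin f g)).
Proof. by move=> f g; apply: endo_eq => x; exact: addrC. Qed.
Fact endoD0 : left_id (Endo endo0_lin) (fun f g => Endo (endoD_lin f g)).
Proof. by move=> f; apply: endo_eq => x; exact: add0r. Qed.
Fact endoDN : left_inverse (Endo endo0_lin) (fun f => Endo (endoN_lin f))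
  (fun f g => Endo (endoD_lin f g)).
Proof. by move=> f; apply: endo_eq => x; exact: addNr. Qed.

HB.instance Definition _ := GRing.isZmodule.Build endo
  endoDA endoDC endoD0 endoDN.

Fact endoMA : associative (fun f g => Endo (endoM_lin f g)).
Proof. by move=> f g h; apply: endo_eq. Qed.
Fact endo1M : left_id (Endo (@id_lin K V)) (fun f g => Endo (endoM_lin f g)).
Proof. by move=> f; apply: endo_eq. Qed.
Fact endoM1 : right_id (Endo (@id_lin K V)) (fun f g => Endo (endoM_lin f g)).
Proof. by move=> f; apply: endo_eq. Qed.
Fact endoMDl : left_distributive (fun f g => Endo (endoM_lin f g)) +%R.
Proof. by move=> f g h; apply: endo_eq. Qed.
Fact endoMDr : right_distributive (fun f g => Endo (endoM_lin f g)) +%R.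
Proof. by move=> f g h; apply: endo_eq => x; exact: (linD (endo_lin f)). Qed.

HB.instance Definition _ := GRing.Zmodule_isPzRing.Build endo
  endoMA endo1M endoM1 endoMDl endoMDr.

Lemma endoME (f g : endo) x : (f * g) x = f (g x). Proof. by []. Qed.

End Endomorphisms.

Section DirectSumMaps.
Variables (K : fieldType) (V : nat -> lmodType K).
Implicit Types x y : dsum V.

Lemma dsumDE x y n : (x + y) n = x n + y n. Proof. by []. Qed.
Lemma dsumZE c x n : (c *: x) n = c *: x n. Proof. by []. Qed.
Lemma dsum_sumE I (s : seq I) (P : pred I) (F : I -> dsum V) n :
  (\sum_(i <- s | P i) F i) n = \sum_(i <- s | P i) F i n.
Proof. exact: (big_morph (fun x : dsum V => x n)). Qed.

Lemma dinj_lin i : linear (@dinj K V i).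
Proof.
move=> c u v; apply: dsum_eq => n; rewrite dsumDE dsumZE /= /dinjf.
by case: eqP => [e|_]; [case: _ / e | rewrite scaler0 addr0].
Qed.

Lemma dinj_inj i : injective (@dinj K V i).
Proof. by move=> u v /(congr1 (fun x : dsum V => x i)); rewrite !dinj_id. Qed.

(** The bound up to which a sum over the components runs is immaterial, which
    frees the sums up to [dbound x] from the choice made in [dbound]. *)
Lemma dsum_wide (P : lmodType K) (g : forall n, V n -> P) x N :
  (forall n, linear (g n)) -> (forall n, (N <= n)%N -> x n = 0) ->
  \sum_(i < dbound x) g i (x i) = \sum_(i < N) g i (x i).
Proof.
move=> lg xN; pose b := maxn (dbound x) N.
have wide M : (M <= b)%N -> (forall n, (M <= n)%N -> x n = 0) ->
    \sum_(i < M) g i (x i) = \sum_(i < b) g i (x i).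
  move=> le_Mb xM; rewrite (big_ord_widen b (fun i => g i (x i)) le_Mb) big_mkcond.
  apply: eq_bigr => i _; case: ltnP => // /xM ->.
  by rewrite (lin0 (lg _)).
by rewrite !wide ?leq_maxl ?leq_maxr //; exact: dboundP.
Qed.

Lemma sum_dinjE (f : forall n, V n) N n :
  (\sum_(i < N) dinj (f i)) n = if (n < N)%N then f n else 0.
Proof.
rewrite dsum_sumE; case: ltnP => [lt_nN|le_Nn].
  rewrite (bigD1 (Ordinal lt_nN)) //= [dinjf _ _](dinj_id (f n)) big1 ?addr0 //.
  move=> i ne_in; apply: (dinj_neq (f i)) => e.
  by move: ne_in; rewrite -val_eqE /= e eqxx.
rewrite big1 // => i _; apply: (dinj_neq (f i)) => e.
by have := ltn_ord i; rewrite e ltnNge le_Nn.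
Qed.

Lemma dsum_decomp x N : (forall n, (N <= n)%N -> x n = 0) ->
  x = \sum_(i < N) dinj (x i).
Proof.
move=> xN; apply: dsum_eq => n; rewrite (sum_dinjE x).
by case: ltnP => // /xN.
Qed.

Lemma dsum_ind (Q : dsum V -> Prop) :
  Q 0 -> (forall i (u : V i) x, Q x -> Q (dinj u + x)) -> forall x, Q x.
Proof.
move=> Q0 QD x; rewrite (dsum_decomp (@dboundP _ _ x)).
by elim/big_rec: _ => // i y _; exact: QD.
Qed.

Definition dlift (P : lmodType K) (g : forall n, V n -> P) x : P :=
  \sum_(i < dbound x) g i (x i).

Section Lift.
Variables (P : lmodType K) (g : forall n, V n -> P).
Hypothesis lg : forall n, linear (@g n).

Lemma dlift_lin : linear (dlift g).
Proof.
move=> c x y; pose N := maxn (dbound (c *: x + y)) (maxn (dbound x) (dbound y)).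
have out z n : (dbound z <= N)%N -> (N <= n)%N -> z n = 0.
  by move=> zN Nn; apply: dboundP; exact: leq_trans Nn.
rewrite /dlift !(dsum_wide (N := N)) //; try by move=> n; apply: out; rewrite /N; lia.
rewrite scaler_sumr -big_split; apply: eq_bigr => i _ /=.
by rewrite -lg.
Qed.

Lemma dliftE n (u : V n) : dlift g (dinj u) = g u.
Proof.
have out m : (n < m)%N -> dinj u m = 0.
  by move=> lt_nm; apply: dinj_neq => e; rewrite e ltnn in lt_nm.
rewrite /dlift (dsum_wide lg out) big_ord_recr big1 /= ?add0r.
  by rewrite [dinjf _ _](dinj_id u).
move=> i _.
rewrite [dinjf _ _](dinj_neq u) ?(lin0 (@lg _)) // => e.
by have := ltn_ord i; rewrite -e ltnn.
Qed.

End Lift.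

Lemma dsum_ext (P : lmodType K) (f g : dsum V -> P) :
  linear f -> linear g ->
  (forall n (u : V n), f (dinj u) = g (dinj u)) -> f =1 g.
Proof.
move=> lf lg fg; apply: dsum_ind => [|i u x IH]; first by rewrite !lin0.
by rewrite !linD // fg IH.
Qed.

End DirectSumMaps.

(** * The tensor algebra and the braid operators on it *)

Lemma comp_lin (K : fieldType) (U V W : lmodType K) (f : V -> W) (g : U -> V) :
  linear f -> linear g -> linear (fun u => f (g u)).
Proof. by move=> lf lg c x y; rewrite lg lf. Qed.

Section TensorAlgebra.
Variables (K : fieldType) (A : algType K) (M : bimodule A).

(** Elements of tensor powers are compared inside the tensor algebra: there the
    two bracketings of a product of degrees [m], [n], [p] have the same type. *)
Definition TA : lmodType K := dsum (fun n => tpow M n : lmodType K).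

Definition tin n (u : tpow M n) : TA := @dinj K (fun n => tpow M n) n u.

Lemma tin_lin n : linear (@tin n).
Proof. exact: dinj_lin. Qed.

Lemma tin_inj n : injective (@tin n).
Proof. exact: dinj_inj. Qed.

Lemma tcons_linr n (x : M) : linear (fun v : tpow M n => tcons x v).
Proof. by have [_ H _] := tcons_balanced M n. Qed.

Fact tconsA_lin (x : M) n : linear (fun v : tpow M n => tin (tcons x v)).
Proof. exact: comp_lin (@tin_lin _) (@tcons_linr n x). Qed.

Definition tconsA (x : M) : endo TA := Endo (dlift_lin (tconsA_lin x)).

Lemma tconsAE x n (v : tpow M n) : tconsA x (tin v) = tin (tcons x v).
Proof. exact: (dliftE (tconsA_lin x)). Qed.

Lemma tin_tcat_tcons m n x (u : tpow M m) (v : tpow M n) :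
  tin (tcat (tcons x u) v) = tconsA x (tin (tcat u v)).
Proof. by rewrite tconsAE; congr tin; exact: tcat_tcons. Qed.

Lemma tin_tcatA m n p (u : tpow M m) (v : tpow M n) (w : tpow M p) :
  tin (tcat (tcat u v) w) = tin (tcat u (tcat v w)).
Proof.
elim: m u => [|m IH] u; first by congr tin; exact/esym/lact_tcat.
apply: (tpow_ext (g := fun u => tin (tcat (tcat u v) w))
                 (h := fun u => tin (tcat u (tcat v w)))) => [||{}x {}u].
- apply: comp_lin (@tin_lin _) _.
  exact: comp_lin (tcat_linl w) (tcat_linl v).
- exact: comp_lin (@tin_lin _) (tcat_linl _).
rewrite tin_tcat_tcons -IH -tin_tcat_tcons; congr tin.
by congr tcat; exact: tcat_tcons.
Qed.

Lemma tin_tcatr0 m (u : tpow M m) (a : A) :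
  tin (tcat u (a : tpow M 0)) = tin (ract u a).
Proof.
elim: m u => [//|m IH] u.
apply: (tpow_ext (g := fun u => tin (tcat u (a : tpow M 0)))
                 (h := fun u => tin (ract u a))) => [||{}x {}u].
- exact: comp_lin (@tin_lin _) (tcat_linl _).
- exact: comp_lin (@tin_lin _) (@ract_linl _ _ _ a).
by rewrite tin_tcat_tcons IH tconsAE ract_tcons.
Qed.

Lemma tpow_ext2 (P : lmodType K) n (g h : tpow M n.+2 -> P) :
  linear g -> linear h ->
  (forall x y (v : tpow M n), g (tcons x (tcons y v)) = h (tcons x (tcons y v))) ->
  g =1 h.
Proof.
move=> lg lh gh; apply: tpow_ext => // x v.
move: v; apply: (tpow_ext (g := fun v => g (tcons x v)) (h := fun v => h (tcons x v))).
- exact: comp_lin lg (@tcons_linr _ x).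
- exact: comp_lin lh (@tcons_linr _ x).
exact: gh.
Qed.

Lemma TA_ext (P : lmodType K) (f g : TA -> P) :
  linear f -> linear g ->
  (forall n (u : tpow M n), f (tin u) = g (tin u)) -> f =1 g.
Proof. exact: dsum_ext. Qed.

End TensorAlgebra.

Section BraidOperators.
Variables (K : fieldType) (A : algType K) (W : dga A).
Local Notation O1 := (Om W 1).
Local Notation T := (tpow O1).
Variables (nabla : O1 -> tensor O1 O1) (sigma : tensor O1 O1 -> tensor O1 O1).
Hypothesis conn : bimodule_connection nabla sigma.
Local Notation braid := (@braid K A W sigma).

Lemma braid_tcatl m n i (u : T m) (v : T n) : (i.+1 < m)%N ->
  @braid (m + n) i.+1 (tcat u v) = tcat (@braid m i.+1 u) v.
Proof.
elim: m i u => [//|m IH] i u lt_im.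
case: i lt_im => [|i] lt_im.
  case: m IH lt_im u => [//|m] _ _.
  apply: (tpow_ext2 (g := fun u : T m.+2 => @braid (m.+2 + n) 1 (tcat u v))
                    (h := fun u => tcat (@braid m.+2 1 u) v)).
  - exact: comp_lin (braid_linear _ _) (tcat_linl v).
  - exact: comp_lin (tcat_linl v) (braid_linear _ _).
  move=> x y {}u.
  rewrite (braid1E conn).
  transitivity (@braid (m + n).+2 1 (tcons x (tcons y (tcat u v)))).
    by congr (@Defs.braid K A W sigma (m + n).+2 1 _); rewrite !tcat_tcons.
  rewrite (braid1E conn); apply: (@tin_inj K A O1 (m + n).+2).
  exact/esym/(@tin_tcatA K A O1 2 m n).
apply: (tpow_ext (g := fun u : T m.+1 => @braid (m.+1 + n) i.+2 (tcat u v))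
                 (h := fun u => tcat (@braid m.+1 i.+2 u) v)).
- exact: comp_lin (braid_linear _ _) (tcat_linl v).
- exact: comp_lin (tcat_linl v) (braid_linear _ _).
move=> x {}u; rewrite (braidSE conn) !tcat_tcons.
by rewrite [LHS](braidSE conn) IH.
Qed.

Lemma braid_tcatr m n i (u : T m) (v : T n) :
  @braid (m + n) (m + i).+1 (tcat u v) = tcat u (@braid n i.+1 v).
Proof.
elim: m u => [|m IH] u; first exact: (braid_lact conn).
apply: (tpow_ext (g := fun u : T m.+1 => @braid (m.+1 + n) (m.+1 + i).+1 (tcat u v))
                 (h := fun u => tcat u (@braid n i.+1 v))).
- exact: comp_lin (braid_linear _ _) (tcat_linl v).
- exact: tcat_linl.
by move=> x {}u; rewrite !tcat_tcons [LHS](braidSE conn) IH.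
Qed.

Fact sgen_lin i n :
  linear (fun u : T n => if (i.+1 < n)%N then tin (@braid n i.+1 u) else 0).
Proof.
case: ltnP => _; last by move=> c x y; rewrite scaler0 addr0.
exact: comp_lin (@tin_lin _ _ _ _) (braid_linear _ _).
Qed.

(** Sigma in the factors [i], [i + 1] counted from 0. On tensor powers with too
    few factors it is 0 and not, like [braid], the identity: in this way the braid
    relations hold for all indices and in all degrees at once. *)
Definition sgen i : endo (TA O1) := Endo (dlift_lin (sgen_lin i)).

Lemma sgenE i n (u : T n) :
  sgen i (tin u) = if (i.+1 < n)%N then tin (@braid n i.+1 u) else 0.
Proof. exact: (dliftE (sgen_lin i)). Qed.

Lemma sgen_tconsA i x : sgen i.+1 * tconsA x = tconsA x * sgen i.
Proof.
apply/endo_eq/TA_ext => [||n u]; [exact: endo_lin.. |].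
rewrite !endoME tconsAE !sgenE ltnS.
case: ltnP => _; last by rewrite (lin0 (endo_lin _)).
by rewrite tconsAE (braidSE conn).
Qed.

Lemma sgen_tcatl m n i (u : T m) (v : T n) : (i.+1 < m)%N ->
  sgen i (tin (tcat u v)) = tin (tcat (@braid m i.+1 u) v).
Proof. by move=> lt_im; rewrite sgenE ltn_addr // braid_tcatl. Qed.

Lemma sgen_tcatr m n i (u : T m) (v : T n) : (i.+1 < n)%N ->
  sgen (m + i) (tin (tcat u v)) = tin (tcat u (@braid n i.+1 v)).
Proof. by move=> lt_in; rewrite sgenE -addnS ltn_add2l lt_in addnS braid_tcatr. Qed.

(** Peeling off common first factors reduces to [i = 0], where the two operators
    act on different factors of a tensor product. *)
Lemma sgen_far i j : (i.+1 < j)%N -> sgen i * sgen j = sgen j * sgen i.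
Proof.
elim: i j => [|i IH] j lt_ij; last first.
  case: j lt_ij => // j lt_ij.
  apply/endo_eq/TA_ext => [||[|n] u]; [exact: endo_lin.. | |].
    by rewrite !endoME !sgenE !(lin0 (endo_lin _)).
  apply: (tpow_ext (g := fun u => (sgen i.+1 * sgen j.+1) (tin u))
                   (h := fun u => (sgen j.+1 * sgen i.+1) (tin u))).
  - exact: comp_lin (endo_lin _) (@tin_lin _ _ _ _).
  - exact: comp_lin (endo_lin _) (@tin_lin _ _ _ _).
  move=> x v; rewrite -tconsAE -!endoME.
  by rewrite -!mulrA !sgen_tconsA !mulrA !sgen_tconsA -!mulrA IH.
case: j lt_ij => [|[|j]] // _.
apply/endo_eq/TA_ext => [||[|[|n]] u]; [exact: endo_lin.. | | |].
- by rewrite !endoME !sgenE !(lin0 (endo_lin _)).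
- by rewrite !endoME !sgenE !(lin0 (endo_lin _)).
apply: (tpow_ext2 (g := fun u => (sgen 0 * sgen j.+2) (tin u))
                   (h := fun u => (sgen j.+2 * sgen 0) (tin u))).
- exact: comp_lin (endo_lin _) (@tin_lin _ _ _ _).
- exact: comp_lin (endo_lin _) (@tin_lin _ _ _ _).
move=> x y v; rewrite !endoME.
have E : tin (tcons x (tcons y v)) = @tin K A O1 (2 + n) (tcat (tmul x y : T 2) v).
  by rewrite tcat2.
have near (t : T 2) (w : T n) :
    sgen 0 (@tin K A O1 (2 + n) (tcat t w)) = tin (tcat (@braid 2 1 t) w).
  exact: sgen_tcatl.
rewrite E near; case: (ltnP j.+1 n) => lt_jn.
  have far (t : T 2) : sgen j.+2 (@tin K A O1 (2 + n) (tcat t v)) =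
      tin (tcat t (@braid n j.+1 v)).
    exact: sgen_tcatr.
  by rewrite !far near.
by rewrite !sgenE -[(2 + n)%N]/(n.+2) !ltnS ltnNge lt_jn (lin0 (endo_lin _)).
Qed.

(** The factorials of the ring of operators agree with those defined directly
    on a tensor power, along any [f] that carries the braidings of [T n] to [s];
    [f] is the inclusion of [T n], or the product by a fixed tensor on one side. *)
Section Action.
Variables (V : lmodType K) (s : nat -> endo V) (n : nat) (f : T n -> V).
Hypothesis lf : linear f.
Hypothesis sf : forall i w, (i.+1 < n)%N -> s i (f w) = f (@braid n i.+1 w).

Lemma bchain_act p j w : (j < p <= n)%N ->
  run (shift (p - j.+1) s) j (f w) = f (bchain sigma p j w).
Proof.
elim: j => [//|j IH] lt_jpn.
rewrite runSl shiftE add1n endoME (_ : (p - j.+2).+1 = p - j.+1)%N; last by lia.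
rewrite IH; last by lia.
rewrite /shift addn0 sf; last by lia.
by rewrite (_ : (p - j.+2).+1 = p - j.+1)%N; last by lia.
Qed.

Lemma bnum_act p w : (p <= n)%N -> bnum s p (f w) = f (bint sigma p w).
Proof.
move=> le_pn; rewrite bnumE /bint (lin_sum lf).
rewrite (big_morph (fun e : endo V => e (f w)) (id1 := 0) (op1 := +%R)) //.
by apply: eq_bigr => j _; rewrite bchain_act // ltn_ord.
Qed.

Lemma bfac_act p w : (p <= n)%N -> bfac s p (f w) = f (bfact sigma p w).
Proof.
elim: p => [//|p IH] lt_pn.
rewrite [bfac s _]/= -/(bnum s p.+1) endoME IH; last exact: ltnW.
exact: bnum_act.
Qed.

End Action.

Lemma bfac_tin n (u : T n) : bfac sgen n (tin u) = tin (brfact sigma u).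
Proof.
apply: bfac_act => // [|i w lt_in]; first exact: tin_lin.
by rewrite sgenE lt_in.
Qed.

Lemma bfac_tcatl m n (u : T m) (v : T n) :
  bfac sgen m (tin (tcat u v)) = tin (tcat (brfact sigma u) v).
Proof.
apply: (bfac_act (f := fun u => tin (tcat u v))) => // [|i w]; last exact: sgen_tcatl.
exact: comp_lin (@tin_lin _ _ _ _) (tcat_linl v).
Qed.

Lemma bfac_tcatr m n (u : T m) (v : T n) :
  bfac (shift m sgen) n (tin (tcat u v)) = tin (tcat u (brfact sigma v)).
Proof.
apply: (bfac_act (f := fun v => tin (tcat u v))) => // [|i w]; last exact: sgen_tcatr.
exact: comp_lin (@tin_lin _ _ _ _) (tcat_linr u).
Qed.

End BraidOperators.

(** * The connection on tensor powers *)

Section BraidRelation.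
Variables (K : fieldType) (A : algType K) (W : dga A).
Local Notation O1 := (Om W 1).
Local Notation T := (tpow O1).
Variables (nabla : O1 -> tensor O1 O1) (sigma : tensor O1 O1 -> tensor O1 O1).
Hypothesis conn : bimodule_connection nabla sigma.
Local Notation braid := (@braid K A W sigma).
Local Notation nab := (@nab K A W nabla sigma).
Local Notation s := (sgen sigma).

Lemma d0_mul (a b : A) : d0 W (a * b) = ract (d0 W a) b + lact a (d0 W b).
Proof.
have := @dif_wedge K A W 0 0 a b; rewrite castf_id expr0 scale1r !wedge0n => E.
have Er : @wedge K A W 1 0 (d0 W a) b = ract (d0 W a) b :> O1.
  by rewrite -(wedgen0 (d0 W a) b) castf_id.
exact: (etrans E (congr1 (fun z : O1 => z + lact a (d0 W b)) Er)).
Qed.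

(** One-forms are spanned by the a db: the right action creates nothing new
    because (db) c = d(bc) - b dc. *)
Lemma Om1_ind (P : O1 -> Prop) :
  (forall c x y, P x -> P y -> P (c *: x + y)) ->
  (forall a b, P (lact a (d0 W b))) -> forall x, P x.
Proof.
move=> Plin Pd.
(* [generated] ranges over all degrees; only its part of degree 1 says anything *)
pose Q n : Om W n -> Prop :=
  match n with 1 => fun x => forall a b, P (lact a (ract x b)) | _ => fun=> True end.
suff gQ n (x : Om W n) : generated (@wedge K A W) (@dif K A W) x -> Q n x.
  move=> x; have := gQ 1 x (dga_generated x) 1 1.
  by rewrite lact1 ract1.
elim=> {n x} //=.
- move=> a b c; have -> : ract (d0 W a) c = d0 W (a * c) - lact a (d0 W c).
    by rewrite d0_mul addrK.
  rewrite (linD (lact_linr b)) (linN (lact_linr b)) -lactM addrC -scaleN1r.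
  by apply: Plin.
- move=> [|[|n]] //= c x y _ IHx _ IHy a b.
  by rewrite (ract_linl b) (lact_linr a); exact: Plin.
- move=> [|[|m]] [|[|n]] //= x y _ IHx _ IHy a b.
  + by rewrite wedge0n -lact_ract -lactM.
  + have -> : @wedge K A W 1 0 x y = ract x y :> O1.
      by rewrite -(wedgen0 (x : Om W 1) y) castf_id.
    by rewrite -ractM.
Qed.

Lemma braid_tmul (t : tensor O1 O1) : @braid 2 1 t = sigma t.
Proof.
move: t; apply: (tpow_ext2 (g := @braid 2 1) (h := sigma)) => [||x y a].
- exact: braid_linear.
- exact: sigma_linear conn.
rewrite (braid1E conn); apply: (@tin_inj K A O1 2).
rewrite (tin_tcatr0 (m := 2)) -(sigma_ract conn); congr (@tin K A O1 2 (sigma _)).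
exact: ract_tmul.
Qed.

Lemma nab_tcons n x (v : T n) :
  nab (tcons x v) = (@tcat K A O1 2 n (nabla x) v : T n.+2) +
                    @braid n.+2 1 (tcons x (nab v)).
Proof.
case: n v => [|n] v; last exact: nabE.
have [_ _ _ nR] := conn.
rewrite [LHS](nR x v) [X in _ = _ + X]braid_tmul; congr (_ + _).
by apply: (@tin_inj K A O1 2); exact/esym/(tin_tcatr0 (m := 2)).
Qed.

Fact nabA_lin n : linear (fun u : T n => tin (nab u)).
Proof. exact: comp_lin (@tin_lin _ _ _ _) (nab_linear conn (n := n)). Qed.

Definition nabA : endo (TA O1) := Endo (dlift_lin nabA_lin).

Lemma nabAE n (u : T n) : nabA (tin u) = tin (nab u).
Proof. exact: (dliftE nabA_lin). Qed.

Lemma nabA_tcons x n (v : T n) : nabA (tin (tcons x v)) =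
  tin (tcat (nabla x : T 2) v) + s 0 (tconsA x (nabA (tin v))).
Proof.
rewrite !nabAE nab_tcons (linD (@tin_lin _ _ _ _)) tconsAE sgenE.
by congr (_ + _).
Qed.

(** To differentiate v, the new one-form has to be moved in front of u, across
    its [m] factors. *)
Lemma nabA_tcat m n (u : T m) (v : T n) :
  nabA (tin (tcat u v)) = tin (tcat (nab u) v) + run s m (tin (tcat u (nab v))).
Proof.
elim: m u => [|m IH] u.
  rewrite nabAE [tcat u v]/= (nab_lact conn) (linD (@tin_lin _ _ _ _)).
  by congr (_ + _); congr tin; rewrite -tcat1.
apply: (tpow_ext (g := fun u => nabA (tin (tcat u v)))
  (h := fun u => tin (tcat (nab u) v) + run s m.+1 (tin (tcat u (nab v)))))
  => [||{}x {}u].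
- exact: comp_lin (endo_lin _) (comp_lin (@tin_lin _ _ _ _) (tcat_linl v)).
- move=> c x y; rewrite (nab_linear conn) !(tcat_linl _ c) !(@tin_lin _ _ _ _ c).
  by rewrite endo_lin scalerDr addrACA.
transitivity (nabA (tin (tcons x (tcat u v)))).
  by rewrite tin_tcat_tcons tconsAE.
rewrite nabA_tcons IH (linD (endo_lin _)) (linD (endo_lin (s 0))) addrA.
rewrite nab_tcons; congr (_ + _).
  rewrite (linD (tcat_linl v)) (linD (@tin_lin _ _ _ _)); congr (_ + _).
    exact/esym/(@tin_tcatA K A O1 2 m n).
  rewrite -tin_tcat_tcons; have := @sgen_tcatl K A W nabla sigma conn m.+2 n 0.
  by apply.
rewrite tin_tcat_tcons runSl endoME -endoME; congr (s 0 _).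
rewrite -[RHS]endoME (run_intertwine (s := s)) // => i _.
exact: sgen_tconsA conn _ _.
Qed.

Hypothesis leib : leibniz_compatible nabla sigma.

(** Both sides of Leibniz compatibility, evaluated on t b with t of degree 2 and
    b in A, fail to be right linear by a term in db, namely sigma_1 sigma_2 sigma_1
    and sigma_2 sigma_1 sigma_2 of t (x) db. Subtracting b times the identity for
    t leaves the braid relation on t (x) db, and such elements span. *)
Lemma braid3 (u : T 3) :
  @braid 3 1 (@braid 3 2 (@braid 3 1 u)) = @braid 3 2 (@braid 3 1 (@braid 3 2 u)).
Proof.
have key (t : T 2) (x : O1) : s 0 (s 1 (s 0 (tin (@tcat _ _ O1 2 1 t x)))) =
    s 1 (s 0 (s 1 (tin (@tcat _ _ O1 2 1 t x)))).
  elim/Om1_ind: x t => [c x y IHx IHy t|a b t].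
    rewrite (@tcat_linr _ _ O1 2 1 t) (@tin_lin _ _ _ _ c).
    by rewrite !(endo_lin _ c) IHx IHy.
  rewrite -(@tcat_bal _ _ O1 2 1); move: (ract t a) => {a}t.
  have N (w : T 2) : nabA (tin (ract w b)) =
     tin (@tcat _ _ O1 3 0 (nab w) b) + s 0 (s 1 (tin (@tcat _ _ O1 2 1 w (d0 W b)))).
    by rewrite -(tin_tcatr0 w b) nabA_tcat /= mul1r.
  have := N (@braid 2 1 t); rewrite !braid_tmul -(sigma_ract conn) -braid_tmul.
  rewrite nabAE leib.
  have S n (w : T n) : (2 < n)%N -> tin (@braid n 2 w) = s 1 (tin w).
    by move=> n_gt; rewrite sgenE n_gt.
  rewrite S // -nabAE N (linD (endo_lin (s 1))) -braid_tmul leib.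
  rewrite -(sgen_tcatl conn (m := 3) (n := 0)) //.
  rewrite -(sgen_tcatl conn (m := 2) (n := 1)) //.
  by move/addrI.
have S i n (w : T n) : (i.+1 < n)%N -> tin (@braid n i.+1 w) = s i (tin w).
  by move=> lt_in; rewrite sgenE lt_in.
apply: (@tin_inj K A O1 3); rewrite !S //.
elim/tpow_ind: u => [|x u w IH].
  by rewrite (lin0 (@tin_lin _ _ _ _)) !(lin0 (endo_lin _)).
rewrite (linD (@tin_lin _ _ _ _)) !(linD (endo_lin _)) IH; congr (_ + _).
move: u; apply: (tpow_ext (g := fun u : T 2 => s 0 (s 1 (s 0 (tin (tcons x u)))))
   (h := fun u : T 2 => s 1 (s 0 (s 1 (tin (tcons x u)))))) => [||y z].
- do 3 apply: comp_lin (endo_lin _) _.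
  exact: comp_lin (@tin_lin _ _ _ _) (@tcons_linr _ _ _ _ x).
- do 3 apply: comp_lin (endo_lin _) _.
  exact: comp_lin (@tin_lin _ _ _ _) (@tcons_linr _ _ _ _ x).
by have := key (tmul x y) z; rewrite (@tcat2 K A O1 1).
Qed.

Lemma sgen_braided : braided s.
Proof.
split=> [|i]; first exact: sgen_far conn.
elim: i => [|i IH]; last first.
  apply/endo_eq/TA_ext => [||[|n] u]; [exact: endo_lin.. | |].
    by rewrite !endoME !sgenE !(lin0 (endo_lin _)).
  apply: (tpow_ext (g := fun u => (s i.+1 * s i.+2 * s i.+1) (tin u))
                   (h := fun u => (s i.+2 * s i.+1 * s i.+2) (tin u))).
  - exact: comp_lin (endo_lin _) (@tin_lin _ _ _ _).
  - exact: comp_lin (endo_lin _) (@tin_lin _ _ _ _).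
  move=> x v; rewrite -tconsAE -!endoME.
  have sl j := sgen_tconsA conn j x.
  rewrite -!mulrA !sl ![s _ * (tconsA x * _)]mulrA !sl.
  by rewrite -!mulrA ![s _ * (tconsA x * _)]mulrA !sl -!mulrA [s i * _]mulrA IH !mulrA.
apply/endo_eq/TA_ext => [||[|[|[|n]]] u]; try exact: endo_lin.
- by rewrite !endoME !sgenE !(lin0 (endo_lin _)).
- by rewrite !endoME !sgenE !(lin0 (endo_lin _)).
- by rewrite !endoME !sgenE ltnn !(lin0 (endo_lin _)).
have lfs e : linear (fun u : T n.+3 => (e : endo (TA O1)) (tin u)).
  exact: comp_lin (endo_lin _) (@tin_lin _ _ _ _).
move: u; apply: (tpow_ext2 (lfs _) (lfs _)) => x y.
apply: (tpow_ext (g := fun u => (s 0 * s 1 * s 0) (tin (tcons x (tcons y u))))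
   (h := fun u => (s 1 * s 0 * s 1) (tin (tcons x (tcons y u))))) => [||z v].
- apply: comp_lin (lfs _) _.
  exact: comp_lin (@tcons_linr _ _ _ _ x) (@tcons_linr _ _ _ _ y).
- apply: comp_lin (lfs _) _.
  exact: comp_lin (@tcons_linr _ _ _ _ x) (@tcons_linr _ _ _ _ y).
have -> : tin (tcons x (tcons y (tcons z v))) =
    @tin K A O1 (3 + n) (tcat (tcons x (tmul y z : T 2) : T 3) v).
  rewrite -tconsAE (@tin_tcat_tcons _ _ _ 2).
  by congr (tconsA x (tin _)); rewrite tcat2.
have sl i (t : T 3) : (i.+1 < 3)%N ->
    s i (@tin K A O1 (3 + n) (tcat t v)) = tin (tcat (@braid 3 i.+1 t) v).
  exact: (sgen_tcatl conn).
by rewrite !endoME !sl // braid3.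
Qed.

(** Differentiating puts one factor in front, so the braidings move up by one.
    In the first two factors this is Leibniz compatibility; a form differentiated
    out of the later factors crosses both of them, and there the claim is the
    braid relation. *)
Lemma nabA_sgen i : nabA * s i = s i.+1 * nabA.
Proof.
have [far rel] := sgen_braided.
elim: i => [|i IH].
  apply/endo_eq/TA_ext => [||[|[|n]] u]; [exact: endo_lin.. | | |].
  - by rewrite !endoME nabAE !sgenE !(lin0 (endo_lin _)).
  - by rewrite !endoME nabAE !sgenE !(lin0 (endo_lin _)).
  apply: (tpow_ext2 (g := fun u => (nabA * s 0) (tin u))
                   (h := fun u => (s 1 * nabA) (tin u))).
  - exact: comp_lin (endo_lin _) (@tin_lin _ _ _ _).
  - exact: comp_lin (endo_lin _) (@tin_lin _ _ _ _).
  move=> x y v; rewrite !endoME.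
  have -> : tin (tcons x (tcons y v)) = @tin K A O1 (2 + n) (tcat (tmul x y : T 2) v).
    by rewrite tcat2.
  rewrite (sgen_tcatl conn) // !nabA_tcat leib (linD (endo_lin (s 1))).
  rewrite -(sgen_tcatl conn (m := 3)) //; congr (_ + _).
  rewrite -[run s 2]/(1 * s 0 * s 1) mul1r -(sgen_tcatl conn (m := 2)) //.
  by rewrite -!endoME rel mulrA.
apply/endo_eq/TA_ext => [||[|n] u]; [exact: endo_lin.. | |].
  by rewrite !endoME nabAE !sgenE !(lin0 (endo_lin _)).
apply: (tpow_ext (g := fun u => (nabA * s i.+1) (tin u))
                   (h := fun u => (s i.+2 * nabA) (tin u))).
- exact: comp_lin (endo_lin _) (@tin_lin _ _ _ _).
- exact: comp_lin (endo_lin _) (@tin_lin _ _ _ _).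
move=> x v; rewrite !endoME -[in LHS]tconsAE -[s i.+1 _]endoME (sgen_tconsA conn).
rewrite endoME; case: (ltnP i.+1 n) => lt_in; last first.
  by rewrite nabAE !sgenE !ltnS ltnNge lt_in !(lin0 (endo_lin _)).
have Ei : s i (tin v) = tin (@braid n i.+1 v) by rewrite sgenE lt_in.
rewrite Ei tconsAE !nabA_tcons -Ei (linD (endo_lin (s i.+2))); congr (_ + _).
  exact/esym/(sgen_tcatr conn (m := 2)).
rewrite -[nabA (s i _)]endoME IH -!endoME -!mulrA.
rewrite [s i.+2 * _]mulrA -far // -mulrA [s i.+2 * _]mulrA.
by rewrite (sgen_tconsA conn) -!mulrA.
Qed.

End BraidRelation.

(** * The higher Leibniz rule *)

Section LeibnizRule.
Variables (K : fieldType) (A : algType K) (W : dga A).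
Local Notation O1 := (Om W 1).
Local Notation T := (tpow O1).
Variables (nabla : O1 -> tensor O1 O1) (sigma : tensor O1 O1 -> tensor O1 O1).
Hypothesis conn : bimodule_connection nabla sigma.
Hypothesis leib : leibniz_compatible nabla sigma.
Local Notation nabA := (nabA conn).
Local Notation nabn := (nabn nabla sigma).
Local Notation s := (sgen sigma).

Lemma nabn_lin n : linear (nabn n).
Proof.
elim: n => [|n IH]; first by [].
exact: comp_lin (nab_linear conn (n := n)) IH.
Qed.

Lemma nabn1 n : nabn n.+1 1 = 0.
Proof.
elim: n => [|n IH]; last first.
  rewrite -[LHS]/(nab nabla sigma (nabn n.+1 1)) IH.
  exact: lin0 (nab_linear conn (n := n.+1)).
have := d0_mul W 1 1; rewrite mulr1 ract1 lact1 => E.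
by apply: (@addrI _ (d0 W 1)); rewrite addr0 [RHS]E.
Qed.

(** The binomial theorem for [nabA], which acts on a product by a sum of two
    operators: the rule of [nabA_tcat] for a product matches Pascal's rule, since
    passing [nabA] through a binomial coefficient shifts it. *)
Theorem nabn_mul n a b : tin (nabn n (a * b)) =
  \sum_(i < n.+1) bbin s n i (tin (tcat (nabn i a) (nabn (n - i) b))).
Proof.
elim: n => [|n IH]; first by rewrite big_ord1.
pose X i j := tin (tcat (nabn i a) (nabn j b)).
have nabX i j : nabA (X i j) = X i.+1 j + run s i (X i j.+1).
  exact: nabA_tcat.
have nabB i x : nabA (bbin s n i x) = bbin (shift 1 s) n i (nabA x).
  rewrite -[LHS]endoME -(bbin_intertwine (s' := shift 1 s)) // => j.
  exact/esym/nabA_sgen.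
transitivity (nabA (tin (nabn n (a * b)))); first by rewrite nabAE.
rewrite IH (lin_sum (endo_lin _)).
pose B1 := bbin (shift 1 s) n.
transitivity (\sum_(i < n.+1) B1 i (X i.+1 (n - i)%N) +
              \sum_(i < n.+1) (B1 i * run s i) (X i (n.+1 - i)%N)).
  rewrite -big_split; apply: eq_bigr => i _.
  by rewrite nabB nabX (linD (endo_lin _)) subSn // -ltnS.
rewrite [X in _ + X]big_ord_recl [RHS]big_ord_recl addrCA /B1 !bbin0 mulr1.
congr (_ + _).
transitivity (\sum_(i < n.+1) B1 i (X i.+1 (n - i)%N) +
              \sum_(i < n.+1) (B1 i.+1 * run s i.+1) (X i.+1 (n - i)%N)).
  by rewrite [X in _ = _ + X]big_ord_recr /B1 bbin_gt // mul0r [X in _ = _ + X]addr0.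
by rewrite -big_split; apply: eq_bigr => i _.
Qed.

(** * The braided-symmetric algebra *)

(** The braided factorial of a product is a function of the braided factorials of
    its two factors. Hence the kernels form a two-sided ideal, and the higher
    Leibniz rule, whose terms have this shape, descends to the quotient. *)
Lemma brfact_tcat m n (u : T m) (v : T n) : tin (brfact sigma (tcat u v)) =
  bbin s (m + n) m (tin (tcat (brfact sigma u) (brfact sigma v))).
Proof.
rewrite -bfac_tin bfac_add; last exact: sgen_braided conn leib.
by rewrite !endoME (bfac_tcatr conn) (bfac_tcatl conn).
Qed.

Local Notation S := (Sdeg sigma).
Local Notation Sproj := (Sproj sigma).
Local Notation SA := (Salg sigma).

Lemma Sproj_lin n : linear (@Defs.Sproj K A W sigma n).
Proof. exact: kpi_linear. Qed.

Lemma Sfact_proj n (u : T n) : Sfact (Sproj u) = brfact sigma u.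
Proof. exact: kinjE. Qed.

Lemma Sfact_inj n : injective (@Sfact K A W sigma n).
Proof. exact: kinj_inj. Qed.

Lemma SprojW n (P : S n -> Prop) : (forall u, P (Sproj u)) -> forall x, P x.
Proof. exact: kpiW. Qed.

Lemma Sfact_lin n : linear (@Sfact K A W sigma n).
Proof.
move=> c; elim/SprojW=> u; elim/SprojW=> v.
by rewrite -Sproj_lin !Sfact_proj brfact_linear.
Qed.

Lemma Sfact_Smulh m n (x : S m) (y : S n) :
  tin (Sfact (Smulh x y)) = bbin s (m + n) m (tin (tcat (Sfact x) (Sfact y))).
Proof. by rewrite Sfact_proj brfact_tcat. Qed.

(** The representatives inside [Smulh] have the same braided factorials as [u]
    and [v]. *)
Theorem Sproj_tcat m n (u : T m) (v : T n) :
  Sproj (tcat u v) = Smulh (Sproj u) (Sproj v).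
Proof.
apply: Sfact_inj; apply: tin_inj.
by rewrite Sfact_Smulh !Sfact_proj brfact_tcat.
Qed.

Lemma Smulh_linl m n (y : S n) : linear (fun x : S m => Smulh x y).
Proof.
move=> c; elim/SprojW=> u; elim/SprojW=> v; elim/SprojW: y => w.
by rewrite -Sproj_lin -!Sproj_tcat tcat_linl Sproj_lin.
Qed.

Lemma Smulh_linr m n (x : S m) : linear (fun y : S n => Smulh x y).
Proof.
move=> c; elim/SprojW=> u; elim/SprojW=> v; elim/SprojW: x => w.
by rewrite -Sproj_lin -!Sproj_tcat tcat_linr Sproj_lin.
Qed.

Fact Sin_lin n : linear (fun x : S n => dinj x : SA).
Proof. exact: dinj_lin. Qed.

Fact Smul_aux_lin m (x : S m) n : linear (fun y : S n => dinj (Smulh x y) : SA).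
Proof. exact: comp_lin (@Sin_lin _) (Smulh_linr x). Qed.

Lemma Smul_linr (x : SA) : linear (Smul x).
Proof.
move=> c y z; rewrite /Smul scaler_sumr -big_split; apply: eq_bigr => i _.
exact: (dlift_lin (Smul_aux_lin (dsf x i))).
Qed.

Fact Smul_aux_linl (y : SA) m :
  linear (fun x : S m => dlift (fun n (z : S n) => dinj (Smulh x z) : SA) y).
Proof.
move=> c x x'; rewrite /dlift scaler_sumr -big_split; apply: eq_bigr => i _.
exact: comp_lin (@Sin_lin _) (Smulh_linl _) c x x'.
Qed.

Lemma Smul_linl (y : SA) : linear (fun x : SA => Smul x y).
Proof. exact: (dlift_lin (Smul_aux_linl y)). Qed.

Lemma Smul_dinj m n (x : S m) (y : S n) :
  Smul (dinj x) (dinj y) = dinj (Smulh x y).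
Proof.
transitivity (dlift (fun n (z : S n) => dinj (Smulh x z) : SA) (dinj y)).
  exact: (dliftE (Smul_aux_linl (dinj y))).
exact: (dliftE (Smul_aux_lin x)).
Qed.

Fact SprojA_lin n : linear (fun u : T n => dinj (Sproj u) : SA).
Proof. exact: comp_lin (@Sin_lin _) (@Sproj_lin n). Qed.

Definition SprojA : TA O1 -> SA := dlift (fun n u => dinj (Sproj u)).

Lemma SprojAE n (u : T n) : SprojA (tin u) = dinj (Sproj u).
Proof. exact: (dliftE SprojA_lin). Qed.

Lemma Salg_ext (P : lmodType K) (f g : SA -> P) : linear f -> linear g ->
  (forall n (u : T n), f (dinj (Sproj u)) = g (dinj (Sproj u))) -> f =1 g.
Proof. by move=> lf lg fg; apply: dsum_ext => // n; elim/SprojW. Qed.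

Lemma Smul_proj m n (u : T m) (v : T n) :
  Smul (dinj (Sproj u)) (dinj (Sproj v)) = SprojA (tin (tcat u v)).
Proof. by rewrite Smul_dinj -Sproj_tcat SprojAE. Qed.

Lemma SmulA (x y z : SA) : Smul (Smul x y) z = Smul x (Smul y z).
Proof.
move: x; apply: Salg_ext => [||m u].
- exact: comp_lin (Smul_linl z) (Smul_linl y).
- exact: Smul_linl.
move: y; apply: Salg_ext => [||n v].
- exact: comp_lin (Smul_linl z) (Smul_linr _).
- exact: comp_lin (Smul_linr _) (Smul_linl z).
move: z; apply: Salg_ext => [||p w].
- exact: Smul_linr.
- exact: comp_lin (Smul_linr _) (Smul_linr _).
by rewrite !Smul_dinj -!Sproj_tcat -!SprojAE tin_tcatA.
Qed.

Definition Sone : SA := dinj (Sproj (1 : T 0)).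

Lemma Smul1l x : Smul Sone x = x.
Proof.
move: x; apply: Salg_ext => [||n u]; [exact: Smul_linr | exact: id_lin |].
by rewrite Smul_proj -SprojAE; congr (SprojA (tin _)); exact: lact1.
Qed.

Lemma Smul1r x : Smul x Sone = x.
Proof.
move: x; apply: Salg_ext => [||n u]; [exact: Smul_linl | exact: id_lin |].
by rewrite Smul_proj -SprojAE tin_tcatr0 ract1.
Qed.

Fact tin_Sfact_lin n : linear (fun x : S n => tin (Sfact x)).
Proof. exact: comp_lin (@tin_lin _ _ _ _) (@Sfact_lin n). Qed.

Definition SfactA : SA -> TA O1 := dlift (fun n x => tin (Sfact x)).

Lemma SfactA_lin : linear SfactA.
Proof. exact: dlift_lin tin_Sfact_lin. Qed.

Lemma SfactAE n (x : S n) : SfactA (dinj x) = tin (Sfact x).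
Proof. exact: (dliftE tin_Sfact_lin). Qed.

Lemma SfactA_inj : injective SfactA.
Proof.
have E x n : SfactA x n = Sfact (x n).
  move: x; apply: dsum_ext => [||m x].
  - by move=> c x y; rewrite SfactA_lin.
  - exact: comp_lin (@Sfact_lin n) _.
  rewrite SfactAE.
  have [<-|/eqP ne_mn] := eqVneq m n; first by rewrite !dinj_id.
  by rewrite !dinj_neq // (lin0 (@Sfact_lin _)).
move=> x y xy; apply: dsum_eq => n; apply: Sfact_inj.
by rewrite -!E xy.
Qed.

Variables (k : nat) (d : forall i : nat, A -> S i).
Hypothesis dE : forall i a, (i <= k)%N -> nabn i a = Sfact (d i a).

Lemma jet_coef_lin i : (i <= k)%N -> linear (d i).
Proof.
move=> le_ik c a b; apply: Sfact_inj.
by rewrite Sfact_lin -!dE // nabn_lin.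
Qed.

Lemma jet_coef_0 a : d 0 a = Sproj (a : T 0).
Proof. by apply: Sfact_inj; rewrite -dE // Sfact_proj. Qed.

Lemma jet_coef_one i : (i < k)%N -> d i.+1 1 = 0.
Proof.
by move=> lt_ik; apply: Sfact_inj; rewrite -dE // nabn1 (lin0 (@Sfact_lin _)).
Qed.

(** After the injective [SfactA], both sides are the two sides of the Leibniz rule
    for [nabn]. *)
Theorem jet_coef_mul n a b : (n <= k)%N ->
  dinj (d n (a * b)) = \sum_(i < n.+1) dinj (Smulh (d i a) (d (n - i) b)) :> SA.
Proof.
move=> le_nk; apply: SfactA_inj.
rewrite (lin_sum SfactA_lin) SfactAE -dE // nabn_mul.
apply: eq_bigr => i _; rewrite SfactAE Sfact_Smulh.
have le_in : (i <= n)%N by rewrite -ltnS.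
rewrite -!dE ?(leq_trans le_in) ?(leq_trans (leq_subr _ _)) //.
by congr (bbin s _ i _); rewrite subnKC.
Qed.

End LeibnizRule.

(** * Jets *)

Section JetBimodule.
Variables (K : fieldType) (A : algType K) (W : dga A).
Local Notation O1 := (Om W 1).
Local Notation T := (tpow O1).
Variables (nabla : O1 -> tensor O1 O1) (sigma : tensor O1 O1 -> tensor O1 O1).
Hypothesis conn : bimodule_connection nabla sigma.
Hypothesis leib : leibniz_compatible nabla sigma.
Local Notation S := (Sdeg sigma).
Local Notation SA := (Salg sigma).
Local Notation tr := (@jet_trunc K A W sigma).
Local Notation Smul_linl := (Smul_linl conn leib).
Local Notation Smul_linr := (Smul_linr conn leib).
Local Notation SmulA := (SmulA conn leib).

Lemma trE k (x : SA) n : tr k x n = if (n < k)%N then x n else 0.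
Proof. exact: (sum_dinjE (dsf x)). Qed.

Lemma tr_lin k : linear (tr k).
Proof.
move=> c x y; apply: dsum_eq => n; rewrite dsumDE dsumZE !trE.
by case: ifP; rewrite // scaler0 addr0.
Qed.

Lemma tr_id k (x : SA) : (forall n, (k <= n)%N -> x n = 0) -> tr k x = x.
Proof. by move=> xk; apply: dsum_eq => n; rewrite trE; case: ltnP => // /xk. Qed.

Lemma tr_tr j k (x : SA) : (j <= k)%N -> tr j (tr k x) = tr j x.
Proof.
move=> le_jk; apply: dsum_eq => n; rewrite !trE.
by case: (ltnP n j) => // lt_nj; rewrite (leq_trans lt_nj).
Qed.

Lemma tr_dinj k n (x : S n) :
  tr k (dinj x) = if (n < k)%N then dinj x else 0.
Proof.
case: ltnP => [lt_nk|le_kn].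
  by apply: tr_id => m le_km; apply: dinj_neq => e; rewrite e ltnNge le_km in lt_nk.
apply: dsum_eq => m; rewrite trE; case: ltnP => // lt_mk.
by apply: dinj_neq => e; rewrite e leqNgt lt_mk in le_kn.
Qed.

Lemma tr_mul_dinjr k (x : SA) j (y : S j) : (j <= k)%N ->
  tr k.+1 (Smul x (dinj y)) = Smul (tr (k - j).+1 x) (dinj y).
Proof.
move=> le_jk; move: x; apply: dsum_ext => [||i x].
- exact: comp_lin (@tr_lin _) (Smul_linl _).
- exact: comp_lin (Smul_linl _) (@tr_lin _).
rewrite (Smul_dinj conn leib) !tr_dinj.
rewrite (_ : (i + j < k.+1) = (i < (k - j).+1))%N; last by lia.
by case: ifP => _; rewrite ?(Smul_dinj conn leib) // (lin0 (Smul_linl _)).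
Qed.

Lemma tr_mul_dinjl k (x : SA) j (y : S j) : (j <= k)%N ->
  tr k.+1 (Smul (dinj y) x) = Smul (dinj y) (tr (k - j).+1 x).
Proof.
move=> le_jk; move: x; apply: dsum_ext => [||i x].
- exact: comp_lin (@tr_lin _) (Smul_linr _).
- exact: comp_lin (Smul_linr _) (@tr_lin _).
rewrite (Smul_dinj conn leib) !tr_dinj.
rewrite (_ : (j + i < k.+1) = (i < (k - j).+1))%N; last by lia.
by case: ifP => _; rewrite ?(Smul_dinj conn leib) // (lin0 (Smul_linr _)).
Qed.

(** The elements without components of degree below [k] form an ideal, so
    truncation may be applied to a factor first. *)
Lemma tr_mull k (x y : SA) : tr k (Smul (tr k x) y) = tr k (Smul x y).
Proof.
move: x; apply: dsum_ext => [||i x].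
- exact: comp_lin (@tr_lin _) (comp_lin (Smul_linl y) (@tr_lin _)).
- exact: comp_lin (@tr_lin _) (Smul_linl y).
rewrite tr_dinj; case: ltnP => // le_ki.
rewrite (lin0 (Smul_linl _)) (lin0 (@tr_lin _)).
move: y; apply: dsum_ext => [||j y].
- by move=> c y y'; rewrite scaler0 addr0.
- exact: comp_lin (@tr_lin _) (Smul_linr _).
by rewrite (Smul_dinj conn leib) tr_dinj ltnNge (leq_trans le_ki) ?leq_addr.
Qed.

Lemma tr_mulr k (x y : SA) : tr k (Smul x (tr k y)) = tr k (Smul x y).
Proof.
move: y; apply: dsum_ext => [||j y].
- exact: comp_lin (@tr_lin _) (comp_lin (Smul_linr x) (@tr_lin _)).
- exact: comp_lin (@tr_lin _) (Smul_linr x).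
rewrite tr_dinj; case: ltnP => // le_kj.
rewrite (lin0 (Smul_linr _)) (lin0 (@tr_lin _)).
move: x; apply: dsum_ext => [||i x].
- by move=> c x x'; rewrite scaler0 addr0.
- exact: comp_lin (@tr_lin _) (Smul_linl _).
by rewrite (Smul_dinj conn leib) tr_dinj ltnNge (leq_trans le_kj) ?leq_addl.
Qed.

Variables (d : forall i : nat, A -> S i).

Lemma jet_dsf k a n : jet d k a n = if (n < k.+1)%N then d n a else 0.
Proof. exact: (sum_dinjE (fun i => d i a)). Qed.

Lemma tr_jet j k a : (j <= k)%N -> tr j.+1 (jet d k a) = jet d j a.
Proof.
move=> le_jk; apply: dsum_eq => n; rewrite trE !jet_dsf.
by case: ifP => // lt_nj; rewrite (leq_trans lt_nj).
Qed.

(** The jet order [k - j] in the action on degree [j] is what survives of the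
    full jet of order [k] when the product is cut off above degree [k]. In this
    form the bimodule axioms are those of the algebra, modulo an ideal. *)
Lemma jet_lactE k a w : jet_lact d k a w = tr k.+1 (Smul (jet d k a) w).
Proof.
rewrite -tr_mulr [X in Smul _ X]/jet_trunc.
rewrite (lin_sum (Smul_linr _)) (lin_sum (@tr_lin _)).
apply: eq_bigr => j _; have le_jk : (j <= k)%N by rewrite -ltnS.
by rewrite tr_mul_dinjr // tr_jet ?leq_subr.
Qed.

Lemma jet_ractE k w a : jet_ract d k w a = tr k.+1 (Smul w (jet d k a)).
Proof.
rewrite -tr_mull [X in Smul X _]/jet_trunc.
rewrite (lin_sum (Smul_linl _)) (lin_sum (@tr_lin _)).
apply: eq_bigr => j _; have le_jk : (j <= k)%N by rewrite -ltnS.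
by rewrite tr_mul_dinjl // tr_jet ?leq_subr.
Qed.

Lemma triangle_sum (V : zmodType) (F : nat -> nat -> V) N :
  \sum_(n < N) \sum_(i < n.+1) F i (n - i)%N = \sum_(i < N) \sum_(j < N - i) F i j.
Proof.
elim: N => [|N IH]; first by rewrite !big_ord0.
rewrite big_ord_recr IH [RHS]big_ord_recr subSnn big_ord1 /=.
rewrite big_ord_recr subnn addrA -big_split; congr (_ + _).
apply: eq_bigr => i _ /=.
by rewrite subSn ?big_ord_recr // ltnW.
Qed.

Variable k : nat.
Hypothesis dE : forall i a, (i <= k)%N -> nabn nabla sigma i a = Sfact (d i a).

Lemma jet_lin : linear (jet d k).
Proof.
move=> c a b; rewrite /jet scaler_sumr -big_split; apply: eq_bigr => i _.
by rewrite (jet_coef_lin conn dE) 1?dinj_lin // -ltnS.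
Qed.

Lemma jet1 : jet d k 1 = Sone sigma.
Proof.
rewrite /jet big_ord_recl (jet_coef_0 dE) big1 ?addr0 // => i _.
by rewrite (jet_coef_one conn dE) ?ltn_ord // (lin0 (@dinj_lin _ _ _)).
Qed.

Lemma jetM a b : jet d k (a * b) = tr k.+1 (Smul (jet d k a) (jet d k b)).
Proof.
transitivity (\sum_(n < k.+1) \sum_(i < n.+1)
    (dinj (Smulh (d i a) (d (n - i) b)) : SA)).
  by apply: eq_bigr => n _; rewrite (jet_coef_mul conn leib dE) // -ltnS.
rewrite (triangle_sum (fun i j => dinj (Smulh (d i a) (d j b)) : SA)).
rewrite [X in Smul X _]/jet (lin_sum (Smul_linl _)) (lin_sum (@tr_lin _)).
apply: eq_bigr => i _; have le_ik : (i <= k)%N by rewrite -ltnS.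
rewrite tr_mul_dinjl // tr_jet ?leq_subr // /jet (lin_sum (Smul_linr _)) subSn //.
by apply: eq_bigr => j _; rewrite (Smul_dinj conn leib).
Qed.

Lemma jet_bimodule : bimodule_on (Jet sigma k) (jet_lact d k) (jet_ract d k).
Proof.
have trJ x : Jet sigma k (tr k.+1 x).
  by move=> n lt_kn; rewrite trE ltnNge lt_kn.
have Jtr x : Jet sigma k x -> tr k.+1 x = x by move=> Jx; apply: tr_id.
split.
- split=> [|c x y Jx Jy n lt_kn|a x _|a x _].
  + by [].
  + by rewrite dsumDE dsumZE Jx // Jy // scaler0 addr0.
  + by rewrite jet_lactE.
  + by rewrite jet_ractE.
- split=> [x Jx|a b x Jx|c a b x Jx|a c x y Jx Jy]; rewrite !jet_lactE.
  + by rewrite jet1 (Smul1l conn leib) Jtr.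
  + by rewrite jetM tr_mull tr_mulr SmulA.
  + by rewrite jet_lin Smul_linl tr_lin.
  + by rewrite Smul_linr tr_lin.
- split=> [x Jx|a b x Jx|c a b x Jx|a c x y Jx Jy]; rewrite !jet_ractE.
  + by rewrite jet1 (Smul1r conn leib) Jtr.
  + by rewrite jetM tr_mull tr_mulr SmulA.
  + by rewrite jet_lin Smul_linr tr_lin.
  + by rewrite Smul_linl tr_lin.
- by move=> a b x Jx; rewrite !jet_lactE !jet_ractE tr_mull tr_mulr SmulA.
Qed.

Lemma jet_bimodule_map :
  bimodule_map_on setT (@lact K A (regular A)) (@ract K A (regular A))
    (Jet sigma k) (jet_lact d k) (jet_ract d k) (jet d k).
Proof.
split=> [a _ n lt_kn|c a b _ _|a b _|a b _].
- by rewrite jet_dsf ltnNge lt_kn.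
- exact: jet_lin.
- by rewrite jet_lactE -jetM.
- by rewrite jet_ractE -jetM.
Qed.

Lemma jet_trunc_map : (0 < k)%N ->
  bimodule_map_on (Jet sigma k) (jet_lact d k) (jet_ract d k)
    (Jet sigma k.-1) (jet_lact d k.-1) (jet_ract d k.-1) (tr k) /\
  (forall a, tr k (jet d k a) = jet d k.-1 a).
Proof.
case: k => // p _.
split; last by move=> a; exact: tr_jet.
split=> [x _ n lt_pn|c x y _ _|a x _|a x _].
- by rewrite trE ltnNge lt_pn.
- exact: tr_lin.
- by rewrite !jet_lactE tr_tr // tr_mulr -tr_mull tr_jet.
- by rewrite !jet_ractE tr_tr // tr_mull -tr_mulr tr_jet.
Qed.

End JetBimodule.

Theorem corollary4p9 (K : fieldType) (A : algType K) (W : dga A)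
    (nabla : Om W 1 -> tensor (Om W 1) (Om W 1))
    (sigma : tensor (Om W 1) (Om W 1) -> tensor (Om W 1) (Om W 1))
    (k : nat) (d : forall i : nat, A -> Sdeg sigma i) :
  bimodule_connection nabla sigma ->
  torsion_free nabla ->
  flat nabla ->
  wedge_compatible nabla sigma ->
  extendable sigma ->
  leibniz_compatible nabla sigma ->
  (forall i, (i <= k)%N ->
     range (nabn nabla sigma i) `<=` range (@brfact K A W sigma i)) ->
  (forall i a, (i <= k)%N -> nabn nabla sigma i a = Sfact (d i a)) ->
  [/\ (forall m n (u : tpow (Om W 1) m) (v : tpow (Om W 1) n),
         Sproj sigma (tcat u v) = Smulh (Sproj sigma u) (Sproj sigma v)),
      bimodule_on (Jet sigma k) (jet_lact d k) (jet_ract d k),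
      bimodule_map_on
        setT (@lact K A (regular A)) (@ract K A (regular A))
        (Jet sigma k) (jet_lact d k) (jet_ract d k)
        (jet d k) &
      (0 < k)%N ->
        bimodule_map_on
          (Jet sigma k) (jet_lact d k) (jet_ract d k)
          (Jet sigma k.-1) (jet_lact d k.-1) (jet_ract d k.-1)
          (jet_trunc k) /\
        (forall a, jet_trunc k (jet d k a) = jet d k.-1 a)].
Proof.
move=> conn _ _ _ _ leib _ dE; split.
- by move=> m n u v; exact: (Sproj_tcat conn leib).
- exact: (jet_bimodule conn leib dE).
- exact: (jet_bimodule_map conn leib dE).
- exact: (jet_trunc_map conn leib).
Qed.
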